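(* Let $G$ be an $n$-vertex, $K_{r+1}$-free graph where $r\ge 3$. (a) If $G$ is not traceable and $n \ge 20$ if $r=3$, $n\ge 1$ if $r \ge 4$, then $e(G) \leq e(T_r(n-1))$. Equality holds if and only if $G$ is $T_r(n-1)$ plus an isolated vertex, i.e., $G \in \mathcal{G}_{n,r}^{-1}$, or $G$ is $K_{3,1}$, $K_{4,1,1}$, or $K_{5,1,1,1}$, with the exceptional graphs occurring in the cases where $r \ge 4$ and $n=4$, or $(r,n)$ is $(4,6)$ or $(4,8)$, respectively. (b) If $G$ is not Hamiltonian and $n \ge 26$ if $r=3$, $n\ge 11$ if $r=4$, $n\ge 2$ if $r \ge 5$, then $e(G) \leq e(T_r(n-1)) + 1$. Equality holds if and only if $G \in \mathcal{G}_{n,r}^{0}$ or $G$ is $K_{3,1,1}$, $K_{6,2,2,1}$, $K_{4,1,1,1}$, or $K_{5,1,1,1,1}$, with the exceptional graphs occurring in the cases where $r \ge 5$ and $n =5$, or $(r,n)$ is $(4,11)$, $(5,7)$, or $(5,9)$, respectively. (c) If $G$ is not Hamiltonian-connected and $n \ge 32$ if $r=3$, $n\ge 16$ if $r=4$, $n\ge 10$ if $r=5$, $n\ge 4$ if $r \ge 6$, then $e(G) \leq e(T_r(n-1)) + 2$. Equality holds if and only if $G \in \mathcal{G}_{n,r}^{1}$ or $G$ is $K_{3,1,1,1}$, $K_{4,1,1,1,1}$, $K_{5,2,1,1,1}$, or $K_{5,1,1,1,1,1}$, with the exceptional graphs occurring in the cases where $r \ge 6$ and $n=6$, or $(r,n)$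 is $(6,8)$, $(5,10)$, or $(6,10)$, respectively. (d) For every $k \ge 0$, if $G$ is not $k$-Hamiltonian and $n \ge 6k+26$ if $r=3$, $n\ge 5k+11$ if $4 \le r \le 7$, $n\ge k+5+4(k+4)/(r-4)$ if $r \ge 8$, then $e(G) \leq e(T_r(n-1)) + (k+1)$. Equality holds if and only if $G \in \mathcal{G}_{n,r}^{k}$ or $G \in \widehat{\mathcal{H}}_{n,r}^{k}$. (e) For every $k \ge 1$, if $G$ is not $k$-Hamiltonian-connected and $n \ge 6k+26$ if $r=3$, $n\ge 5k+11$ if $r=4$, $n\ge 3k+7$ if $5 \le r \le 7$, $n\ge k+5+4(k+4)/(r-4)$ if $r \ge 8$, then $e(G) \leq e(T_r(n-1)) + (k+1)$. Equality holds if and only if $G \in \mathcal{G}_{n,r}^{k}$ or $G \in \widehat{\mathcal{H}}_{n,r}^{k}$. (f) For every $k \ge 1$, if $G$ is not $k$-connected and $n \ge 6k+14$ if $r=3$, $n\ge 5k+1$ if $4 \le r \le 7$, $n\ge 2k+5$ if $r \ge 8$, then $e(G) \leq e(T_r(n-1)) + (k-1)$. Equality holds if and only if $G \in \mathcal{G}_{n,r}^{k-2}$. In all cases $\mathcal{G}_{n,r}^{\ell}$ is nonempty (where $\ell=-1,0,1,k,k,k-2$ in parts (a)--(f), respectively), and the bounds are tight.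
   Context: Graphs are finite and simple; $n,r,k$ are integers; $e(G)$ is the number of edges of $G$. $T_r(n)$ is the $n$-vertex, $r$-partite Turán graph: the complete $r$-partite graph on $n$ vertices with part sizes differing by at most 1 (if $n<r$ some parts are empty and it is $K_n$). $K_{a_1,\dots,a_s}$ is the complete multipartite graph with parts of sizes $a_1,\dots,a_s$. A graph is traceable if it contains a Hamiltonian path, Hamiltonian if it contains a Hamiltonian cycle, and Hamiltonian-connected if every pair of distinct vertices is connected by a Hamiltonian path. An $n$-vertex graph $G$ is $k$-Hamiltonian ($0\le k\le n-3$) if for each set $S$ of at most $k$ vertices $G-S$ is Hamiltonian; $k$-Hamiltonian-connected ($1\le k\le n-2$) if for each set $S$ of fewer than $k$ vertices $G-S$ is Hamiltonian-connected; $k$-connected ($1\le k\le n-1$) if for each set $S$ of fewer than $k$ vertices $G-S$ is connected. For $\ell\ge -1$, $\mathcal{G}_{n,r}^{\ell}$ is the set of $n$-vertex, $K_{r+1}$-free graphs consisting of $T_r(n-1)$ plus one additional vertex of degree $\ell+1$. $\widehat{\mathcal{H}}_{n,r}^{\ell}$ is the set of all graphs $G$ such that $(G,r,n)$ appears in the following list for the given $\ell$ (it is empty for parameters not listed): - $\ell=-1$: $(K_{4,1,1}, 4, 6)$, $(K_{5,1,1,1}, 4, 8)$; - $\ell=0$: $(K_{6,2,2,1},4,11)$, $(K_{4,1,1,1},5,7)$, $(K_{5,1,1,1,1},5,9)$; - $\ell=1$: $(K_{4,1,1,1,1},6,8)$, $(K_{5,2,1,1,1},5,10)$, $(K_{5,1,1,1,1,1},6,10)$;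 - $\ell=2$: $(K_{6,2,2,2,1}, 5, 13)$, $(K_{5,2,1,1,1,1}, 6, 11)$, $(K_{5,1,1,1,1,1,1}, 7, 11)$, $(K_{4,1,1,1,1,1}, 7, 9)$; - $\ell=3$: $(K_{5,2,1,1,1,1,1}, 7, 12)$; - $\ell=4$: $(K_{6,2,2,2,2,1}, 6, 15)$, $(K_{5,2,2,1,1,1,1}, 7, 13)$; - $\ell=6$: $(K_{6,2,2,2,2,2,1}, 7, 17)$. ''Tight'' means that equality is attained by some graph satisfying the hypotheses.
   Formalization: In (a), tightness is claimed only for n ≥ 2: for n = 1 (allowed when r ≥ 4) the only graph is K_1, which is traceable, so no graph satisfies the hypotheses and the bound cannot be attained. *)

(* Defs.v *)
From mathcomp Require Export all_boot all_order all_algebra.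

Set Implicit Arguments.
Unset Strict Implicit.
Unset Printing Implicit Defensive.

Record sgraph := SGraph {
  vertex :> finType;
  adj : rel vertex;
  adj_sym : symmetric adj;
  adj_irrefl : irreflexive adj }.

Arguments adj {s} _ _.

Definition iso (G H : sgraph) : Prop :=
  exists2 f : G -> H, bijective f & forall x y, adj (f x) (f y) = adj x y.

Definition edges (G : sgraph) : {set {set G}} :=
  [set [set p.1; p.2] | p : G * G & adj p.1 p.2].

Definition nedges (G : sgraph) : nat := #|edges G|.

Definition degree (G : sgraph) (v : G) : nat := #|[set w | adj v w]|.

Definition clique_free (s : nat) (G : sgraph) : Prop :=
  forall A : {set G}, #|A| = s -> ~ {in A &, forall x y, x != y -> adj x y}.

Section Delete.
Variables (G : sgraph) (S : {set G}).

Definition del_adj : rel {x : G | x \notin S} := fun x y => adj (val x) (val y).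

Lemma del_adj_sym : symmetric del_adj.
Proof. by move=> x y; rewrite /del_adj adj_sym. Qed.

Lemma del_adj_irrefl : irreflexive del_adj.
Proof. by move=> x; rewrite /del_adj adj_irrefl. Qed.

Definition del : sgraph := SGraph del_adj_sym del_adj_irrefl.
End Delete.

Section Multipartite.
Variables (V : finType) (I : eqType) (part : V -> I).

Definition part_adj : rel V := fun x y => part x != part y.

Lemma part_adj_sym : symmetric part_adj.
Proof. by move=> x y; rewrite /part_adj eq_sym. Qed.

Lemma part_adj_irrefl : irreflexive part_adj.
Proof. by move=> x; rewrite /part_adj eqxx. Qed.

Definition multipartite : sgraph := SGraph part_adj_sym part_adj_irrefl.
End Multipartite.

(* K_{a_1, ..., a_s} for a = [:: a_1; ...; a_s]; the vertices are the pairs of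
   a part i and an index below a_i. *)
Definition Kmulti (a : seq nat) : sgraph :=
  multipartite (fun x : {i : 'I_(size a) & 'I_(nth 0 a i)} => tag x).

(* T_r(n), for 0 < r: the parts are the residue classes mod r in {0, ..., n-1},
   whose sizes differ by at most 1. *)
Definition turan (r n : nat) : sgraph := multipartite (fun i : 'I_n => i %% r).

(* The vertices of x :: p, in this order, form a Hamiltonian path; a path may
   consist of a single vertex, so the one-vertex graph is traceable. *)
Definition ham_path (G : sgraph) (x : G) (p : seq G) : Prop :=
  [/\ path adj x p, uniq (x :: p) & forall z, z \in x :: p].

Definition ham_cycle (G : sgraph) (c : seq G) : Prop :=
  [/\ 2 < size c, ucycle adj c & forall z, z \in c].

Definition traceable (G : sgraph) : Prop :=
  exists x : G, exists p : seq G, ham_path x p.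

Definition hamiltonian (G : sgraph) : Prop :=
  exists c : seq G, ham_cycle c.

Definition ham_connected (G : sgraph) : Prop :=
  forall x y : G, x != y -> exists2 p : seq G, ham_path x p & last x p = y.

Definition connected (G : sgraph) : Prop :=
  forall x y : G, connect adj x y.

(* The three notions below are meant for k <= n - 3, 1 <= k <= n - 2 and
   1 <= k <= n - 1 respectively, where n = #|G|. *)
Definition k_hamiltonian (k : nat) (G : sgraph) : Prop :=
  forall S : {set G}, #|S| <= k -> hamiltonian (del S).

Definition k_ham_connected (k : nat) (G : sgraph) : Prop :=
  forall S : {set G}, #|S| < k -> ham_connected (del S).

Definition k_connected (k : nat) (G : sgraph) : Prop :=
  forall S : {set G}, #|S| < k -> connected (del S).

(* G is in \mathcal{G}_{n,r}^l. *)
Definition in_calG (n r : nat) (l : int) (G : sgraph) : Prop :=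
  [/\ #|G| = n, clique_free r.+1 G
    & exists2 v : G, ((degree v)%:Z = l + 1)%R
                   & iso (del [set v]) (turan r (n - 1))].

(* An entry (l, a, r, n) puts K_a in \widehat{\mathcal{H}}_{n,r}^l. *)
Definition Hhat_table : seq (int * seq nat * nat * nat) :=
  [:: ((-1)%R, [:: 4; 1; 1], 4, 6);
      ((-1)%R, [:: 5; 1; 1; 1], 4, 8);
      (0%R, [:: 6; 2; 2; 1], 4, 11);
      (0%R, [:: 4; 1; 1; 1], 5, 7);
      (0%R, [:: 5; 1; 1; 1; 1], 5, 9);
      (1%R, [:: 4; 1; 1; 1; 1], 6, 8);
      (1%R, [:: 5; 2; 1; 1; 1], 5, 10);
      (1%R, [:: 5; 1; 1; 1; 1; 1], 6, 10);
      (2%R, [:: 6; 2; 2; 2; 1], 5, 13);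
      (2%R, [:: 5; 2; 1; 1; 1; 1], 6, 11);
      (2%R, [:: 5; 1; 1; 1; 1; 1; 1], 7, 11);
      (2%R, [:: 4; 1; 1; 1; 1; 1], 7, 9);
      (3%R, [:: 5; 2; 1; 1; 1; 1; 1], 7, 12);
      (4%R, [:: 6; 2; 2; 2; 2; 1], 6, 15);
      (4%R, [:: 5; 2; 2; 1; 1; 1; 1], 7, 13);
      (6%R, [:: 6; 2; 2; 2; 2; 2; 1], 7, 17)].

Definition in_Hhat (n r : nat) (l : int) (G : sgraph) : Prop :=
  exists2 a : seq nat, (l, a, r, n) \in Hhat_table & iso G (Kmulti a).

(* Main.v *)
(** Write m for the number of extra edges allowed over the Turán graph T_r(n-1).
    Chvátal's degree-sequence argument turns each failed property (after deleting S in
    the k-versions) into: some vertex has degree at most m, or for some i >= 2 with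
    2i + m <= n at least i vertices have degree < i + m and at least n + 1 - i - m have
    degree < n - i.  Traceability and Hamiltonian-connectedness reduce to spanning
    cycles by adding an apex vertex.  Deleting i vertices of degree < i + m and applying
    Turán's theorem bounds the number of edges by f(i) = t_r(n-i) + i(i+m-1), and
    f(1) = t_r(n-1) + m.  For r >= 4 one has f(i) <= f(1), with equality only if
    2i + m = n; the deleted set I is then independent, all its vertices miss the same
    vertex w, which is a singleton class of the Turán graph on the rest, and the
    degree condition leaves finitely many sporadic graphs besides K_{3,1,...,1}.
    For r = 3 and i >= 3, f(i) may exceed f(1); there Erdős's majorization of the
    degrees by those of a complete tripartite graph gives a strict inequality. *)

Require Import Defs.
From mathcomp Require Import zify.
From Stdlib Require Import Classical.

Set Implicit Arguments.
Unset Strict Implicit.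
Unset Printing Implicit Defensive.

Import Order.TTheory GRing.Theory Num.Theory.

(** * Degrees and Erdős majorization *)

(** The shift [m] is 0 for traceability, 1 for Hamiltonicity, 2 for Hamiltonian-connectedness and 0
    for connectedness, and a deleted set [S] adds [#|S|]; so all six parts become one statement
    about [low m G]. The second half of Chvátal's condition, the many vertices of degree < n - i,
    acts in two places. At equality for r >= 4 one has n - i = i + m, and it supplies one more low
    vertex, lying outside I: the vertex w. For r = 3 it settles the borderline case n = 20, m = 0, i
    = 10. Comparing f(i) with f(1) comes down to a sum of i - 1 floors of (n - i + j) / r, bounded
    by pairing terms from both ends. At r = 3 these floors are too large; majorization helps because
    it measures the remaining degrees against colour classes of the whole graph, which also contain
    the low vertices. *)

Lemma card_set_sum (T : finType) (A : {set T}) (P : pred T) :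
  #|[set y in A | P y]| = \sum_(y in A) P y.
Proof.
rewrite -sum1_card big_mkcond [RHS]big_mkcond /=.
by apply: eq_bigr => y _; rewrite inE; case: (y \in A) => //=; case: (P y).
Qed.

Section InducedDegree.
Variable G : sgraph.
Implicit Types (A B : {set G}) (x y : G).

Definition degree_in A x := #|[set y in A | adj x y]|.

Definition degree_sum A := \sum_(x in A) degree_in A x.

Lemma degree_inT x : degree_in setT x = degree x.
Proof. by apply: eq_card => y; rewrite !inE. Qed.

Lemma degree_inE A x : degree_in A x = \sum_(y in A) adj x y.
Proof.
exact: card_set_sum.
Qed.

Lemma degree_in_le A x : degree_in A x <= #|A|.
Proof. by apply: subset_leq_card; apply/subsetP=> y; rewrite inE => /andP[]. Qed.

Lemma degree_inC A x : degree x = degree_in A x + degree_in (~: A) x.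
Proof.
rewrite -degree_inT !degree_inE (bigID (mem A)) /=.
by congr (_ + _); apply: eq_bigl => y; rewrite !inE.
Qed.

(** Each edge is the image of exactly two ordered adjacent pairs. *)
Lemma handshake : (nedges G).*2 = \sum_(x : G) degree x.
Proof.
pose D := [set p : G * G | adj p.1 p.2].
pose h (p : G * G) := [set p.1; p.2].
have -> : \sum_(x : G) degree x = #|D|.
  have -> : #|D| = \sum_(p : G * G | true && adj p.1 p.2) 1.
    by rewrite sum1dep_card.
  rewrite -(pair_big_dep xpredT (fun x y : G => adj x y) (fun _ _ => 1)) /=.
  by apply: eq_bigr => x _; rewrite sum1dep_card; apply: eq_card => y; rewrite !inE.
have -> : nedges G = #|h @: D|.
  by rewrite /nedges; congr #|pred_of_set _|; apply/setP => X; apply/imsetP/imsetP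
    => -[p pD ->]; exists p => //; rewrite inE in pD *.
rewrite -[#|D|]sum1_card (partition_big_imset h) /= -muln2 -sum_nat_const.
apply: eq_bigr => X /imsetP[[x y] xyD ->]; have {xyD} xy : adj x y by rewrite inE in xyD.
have nxy : x != y by apply: contraTneq xy => ->; rewrite adj_irrefl.
rewrite sum1dep_card.
have -> : [set p in D | h p == h (x, y)] = [set (x, y); (y, x)].
  apply/setP => -[a b]; rewrite !inE /= !xpair_eqE.
  apply/andP/orP => [[ab /eqP E]|].
    have : (a \in h (x, y)) && (b \in h (x, y)) by rewrite -E !inE !eqxx orbT.
    rewrite !inE /= => /andP[/orP[] /eqP ? /orP[] /eqP ?]; subst a b;
      rewrite ?adj_irrefl // in ab *; rewrite ?eqxx; by [left|right].
  case=> /andP[/eqP-> /eqP->]; split=> //; first by rewrite adj_sym.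
  by rewrite /h /= setUC.
rewrite cards2 xpair_eqE; case: eqP nxy => //.
Qed.

Lemma degree_sumT : degree_sum setT = (nedges G).*2.
Proof.
rewrite handshake /degree_sum; apply: eq_big => [x|x _]; first by rewrite inE.
exact: degree_inT.
Qed.

(** Prices the deletion of [A], without subtraction. The term [degree_sum A], twice the number of
    edges inside [A], is a slack that vanishes exactly when [A] is independent. *)
Lemma nedges_split A :
  (nedges G).*2 + degree_sum A = degree_sum (~: A) + (\sum_(x in A) degree x).*2.
Proof.
rewrite handshake (bigID (mem A)) /= /degree_sum.
have -> : \sum_(x | x \notin A) degree x =
   \sum_(x in ~: A) degree_in A x + \sum_(x in ~: A) degree_in (~: A) x.
  rewrite -big_split /=; apply: eq_big => [x|x _]; first by rewrite inE.
  exact: degree_inC.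
have E : \sum_(x in A) degree x =
   \sum_(x in A) degree_in A x + \sum_(x in A) degree_in (~: A) x.
  by rewrite -big_split /=; apply: eq_bigr => x _; apply: degree_inC.
have S : \sum_(x in ~: A) degree_in A x = \sum_(x in A) degree_in (~: A) x.
  under eq_bigr do rewrite degree_inE; under [RHS]eq_bigr do rewrite degree_inE.
  rewrite exchange_big /=; apply: eq_bigr => x _; apply: eq_bigr => y _.
  by rewrite adj_sym.
rewrite S E; lia.
Qed.

Lemma degree_lt_card x : degree x < #|G|.
Proof.
rewrite -cardsT (cardsD1 x) inE /= add1n ltnS; apply: subset_leq_card.
by apply/subsetP => y; rewrite !inE andbT; apply: contraTneq => ->; rewrite adj_irrefl.
Qed.

End InducedDegree.

Definition clique (G : sgraph) (A : {set G}) : Prop :=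
  {in A &, forall x y, x != y -> adj x y}.

(** Relative to a vertex set, so that recursion into neighbourhoods and Turán's theorem after a
    deletion stay in the same graph. *)
Definition clique_free_in (s : nat) (G : sgraph) (B : {set G}) : Prop :=
  forall A : {set G}, A \subset B -> #|A| = s -> ~ clique A.

(* Erdős majorization: delete the non-neighbours of a vertex of maximum degree,
   give them a new colour, and recurse in its neighbourhood. *)
Lemma erdos_majorization (G : sgraph) r (A : {set G}) :
  clique_free_in r.+1 A ->
  exists c : G -> nat,
    [/\ forall x, x \in A -> c x < r,
        forall x, x \in A -> degree_in A x + #|[set y in A | c y == c x]| <= #|A|
      & (forall x, x \in A -> degree_in A x + #|[set y in A | c y == c x]| = #|A|) ->
        {in A &, forall x y, adj x y = (c x != c y)}].
Proof.
elim: r A => [|r IH] A cfA.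
  have A0 x : x \in A -> False.
    move=> xA; apply: (cfA [set x]); rewrite ?sub1set ?cards1 //.
    by move=> a b; rewrite !inE => /eqP-> /eqP->; rewrite eqxx.
  by exists (fun _ => 0); split=> [x /A0|x /A0|_ x y /A0].
case: (set_0Vmem A) => [->|[x0 x0A]].
  by exists (fun _ => 0); split=> [x|x|_ x y]; rewrite inE.
pose v := [arg max_(x > x0 in A) degree_in A x].
have [vA vmax] : v \in A /\ forall x, x \in A -> degree_in A x <= degree_in A v.
  by rewrite /v; case: arg_maxnP.
pose B := [set y in A | adj v y].
have sBA : B \subset A by apply/subsetP => y; rewrite inE => /andP[].
have cB : #|B| = degree_in A v by [].
have cfB : clique_free_in r.+1 B.
  move=> K sKB cK clK; apply: (cfA (v |: K)).
  - by rewrite subUset sub1set vA (subset_trans sKB).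
  - rewrite cardsU1 cK; suff -> : v \notin K by [].
    by apply/negP => /(subsetP sKB); rewrite inE adj_irrefl andbF.
  - move=> x y; rewrite !inE => /orP[/eqP->|xK] /orP[/eqP->|yK]; rewrite ?eqxx //.
    + by move: (subsetP sKB _ yK); rewrite inE => /andP[].
    + by move: (subsetP sKB _ xK); rewrite inE adj_sym => /andP[].
    + exact: clK.
have [c [cr cm ce]] := IH B cfB.
pose d x := if x \in B then c x else r.
have inBA x : x \in B -> x \in A by apply/subsetP.
have dB x : x \in B -> [set y in A | d y == d x] = [set y in B | c y == c x].
  move=> xB; apply/setP => y; rewrite !inE /d xB.
  have := cr _ xB; case: (boolP (y \in B)) => yB; move: (yB); rewrite inE.
    by move=> /andP[-> ->].
  move=> /negPf-> lt; rewrite andFb; case: (y \in A) => //=.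
  by rewrite gtn_eqF.
have dC x : x \in A -> x \notin B -> [set y in A | d y == d x] = A :\: B.
  move=> xA xB; apply/setP => y; rewrite in_set in_setD /d (negPf xB).
  case: (boolP (y \in B)) => yB /=; last by rewrite eqxx andbT.
  by rewrite ltn_eqF ?andbF ?cr.
have cAB : #|A :\: B| + #|B| = #|A|.
  by rewrite -(cardsID B A) (setIidPr sBA) addnC.
have degB x : degree_in A x = degree_in B x + degree_in (A :\: B) x.
  by rewrite !degree_inE (big_setID B) /= (setIidPr sBA).
have degB_le x : degree_in A x <= degree_in B x + #|A :\: B|.
  by rewrite degB leq_add2l degree_in_le.
exists d; split.
- by move=> x _; rewrite /d; case: ifP => [/cr|_]; lia.
- move=> x xA; case: (boolP (x \in B)) => xB.
    rewrite (dB _ xB); have := cm _ xB; have := degB_le x; lia.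
  by rewrite (dC _ xA xB); have := vmax x xA; rewrite -cB; lia.
move=> eqd.
(* Equality at a neighbour of [v] splits in two: equality in the recursive bound, and adjacency to
   all of [A :\: B]. *)
have eqB x : x \in B ->
   degree_in B x + #|[set y in B | c y == c x]| = #|B| /\
   degree_in (A :\: B) x = #|A :\: B|.
  move=> xB; have := eqd x (inBA _ xB); rewrite (dB _ xB).
  have := cm _ xB; have := degB x; have := degree_in_le (A :\: B) x; lia.
have fullB x y : x \in B -> y \in A :\: B -> adj x y.
  move=> xB yAB; have [_ E] := eqB x xB.
  have /setP/(_ y) : [set z in A :\: B | adj x z] = A :\: B.
    apply/eqP; rewrite eqEcard; apply/andP; split.
      by apply/subsetP => z; rewrite inE => /andP[].
    by rewrite -[#|[set _ in _ | _]|]/(degree_in (A :\: B) x) E.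
  by rewrite yAB inE yAB.
(* The class of [x] is [A :\: B], so equality leaves [x] exactly [#|B|] neighbours in [A], and [B]
   already provides them. *)
have noC x y : x \in A -> x \notin B -> y \in A -> y \notin B -> ~~ adj x y.
  move=> xA xB yA yB; have := eqd x xA; rewrite (dC _ xA xB) degB => E.
  have EB : degree_in B x = #|B|.
    apply: eq_card => z; rewrite inE; case: (boolP (z \in B)) => //= zB.
    by rewrite adj_sym fullB // in_setD xB xA.
  apply/negP => axy.
  have : degree_in (A :\: B) x > 0.
    by apply/card_gt0P; exists y; rewrite in_set in_setD yA axy yB.
  lia.
move=> x y xA yA; rewrite /d.
case: (boolP (x \in B)) => xB; case: (boolP (y \in B)) => yB.
- by apply: ce => // z zB; have [] := eqB z zB.
- by rewrite fullB ?in_setD ?yB ?yA //; have := cr _ xB; case: eqP => // ->; rewrite ltnn.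
- rewrite adj_sym fullB ?in_setD ?xB ?xA //.
  by have := cr _ yB; case: eqP => // <-; rewrite ltnn.
- by rewrite eqxx (negPf (noC _ _ xA xB yA yB)).
Qed.

(** * Turán's theorem *)

Lemma sum_class_size (T : finType) r (A : {set T}) (c : T -> nat) :
  (forall x, x \in A -> c x < r) ->
  \sum_(k < r) #|[set y in A | c y == k]| = #|A|.
Proof.
move=> cr; rewrite -sum1_card.
rewrite (eq_bigr (fun k : 'I_r => \sum_(y in A) (c y == k))); last first.
  by move=> k _; apply: card_set_sum.
rewrite exchange_big /=; apply: eq_bigr => x xA.
rewrite (eq_bigr (fun k : 'I_r => if c x == k then 1 else 0)); last by move=> k _; case: eqP.
rewrite -big_mkcond /= (big_pred1 (Ordinal (cr x xA))) //.
Qed.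

Lemma sum_class_size_sqr (T : finType) r (A : {set T}) (c : T -> nat) :
  (forall x, x \in A -> c x < r) ->
  \sum_(x in A) #|[set y in A | c y == c x]| =
  \sum_(k < r) #|[set y in A | c y == k]| ^ 2.
Proof.
move=> cr.
transitivity (\sum_(k < r) \sum_(x in A | c x == k) #|[set y in A | c y == c x]|).
  under [RHS]eq_bigr do rewrite big_mkcondr.
  rewrite exchange_big /=; apply: eq_bigr => x xA.
  rewrite -big_mkcond /= (big_pred1 (Ordinal (cr x xA))) //.
apply: eq_bigr => k _.
rewrite (eq_bigr (fun _ => #|[set y in A | c y == k]|)); last first.
  by move=> x /andP[_ /eqP->].
rewrite sum_nat_const -mulnn; congr (_ * _).
by apply: eq_card => x; rewrite !inE.
Qed.

(** In the residue-class model vertex [x] has [x %/ r] earlier vertices in its own class, hence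
    [x - x %/ r] earlier neighbours. *)
Definition turan_number r n := \sum_(x < n) (x - x %/ r).

Lemma turan_numberS r n : turan_number r n.+1 = turan_number r n + (n - n %/ r).
Proof. exact: big_ord_recr. Qed.

Lemma divn_modnS r n : 0 < r ->
  (n %% r).+1 = r /\ (n.+1 %/ r = (n %/ r).+1 /\ n.+1 %% r = 0) \/
  (n %% r).+1 < r /\ (n.+1 %/ r = n %/ r /\ n.+1 %% r = (n %% r).+1).
Proof.
move=> r0; have lt := ltn_pmod n r0.
have E : n.+1 = n %/ r * r + (n %% r).+1 by rewrite addnS -divn_eq.
case: (ltnP (n %% r).+1 r) => h; [right|left]; split=> //; try lia.
  rewrite {1 2}E divnMDl // modnMDl (divn_small h) addn0 (modn_small h).
  by [].
have h' : (n %% r).+1 = r by lia.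
by rewrite E h' divnMDl // modnMDl divnn modnn r0 addn1.
Qed.

(** With q = [n %/ r], a balanced class size s satisfies s^2 = (2q + 1)s - q(q + 1); summing over
    the r classes gives n^2 - 2t_r(n). *)
Lemma turan_number_double r n : 0 < r ->
  (turan_number r n).*2 + ((n %/ r).*2 + 1) * n = n ^ 2 + r * (n %/ r * (n %/ r).+1).
Proof.
move=> r0; elim: n => [|n IH].
  by rewrite /turan_number big_ord0 div0n; lia.
have D := divn_eq n r; have L := leq_div n r.
case: (divn_modnS n r0) => [[E1 [E2 _]]|[E1 [E2 _]]]; rewrite turan_numberS E2;
  move: IH L D E1; move: (n %/ r) (turan_number r n) (n %% r) => q T t IH L D E1;
  rewrite -!mulnn in IH *; last by lia.
have F : r * q.+1 = n.+1 by lia.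
have F1 : r * (q.+1 * q.+2) = n.+1 * q.+2 by rewrite mulnA F.
have F2 : r * (q * q.+1) = q * n.+1 by rewrite mulnCA F.
lia.
Qed.

(** This is (s - q)(s - q - 1) >= 0 over the integers. It linearizes the sum of squares in Turán's
    theorem and carries its equality case. *)
Lemma leqif_sqr_consecutive s q :
  (q.*2 + 1) * s <= s ^ 2 + q * q.+1 ?= iff (q <= s <= q.+1).
Proof.
rewrite -mulnn; case: (leqP s q) => [/subnKC|/subnKC]; set a := _ - _ => <-.
  case: a => [|a]; split; lia.
case: a => [|a]; split; lia.
Qed.

Lemma turan_bound (G : sgraph) r (A : {set G}) : 0 < r ->
  clique_free_in r.+1 A -> degree_sum A <= (turan_number r #|A|).*2.
Proof.
move=> r0 /erdos_majorization[c [cr cm _]].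
have T := turan_number_double #|A| r0.
have S1 := sum_class_size cr; have S2 := sum_class_size_sqr cr.
have : degree_sum A + \sum_(x in A) #|[set y in A | c y == c x]| <= #|A| * #|A|.
  by rewrite -big_split /= -sum_nat_const leq_sum.
rewrite S2; set q := #|A| %/ r in T.
have : (q.*2 + 1) * #|A| <=
    \sum_(k < r) #|[set y in A | c y == k]| ^ 2 + r * (q * q.+1).
  rewrite -[in X in X <= _]S1 -[r in r * (q * _)]card_ord -sum_nat_const -big_split /=.
  by rewrite big_distrr /= leq_sum // => k _; apply: leqif_sqr_consecutive.
lia.
Qed.

(** Both inequalities behind [turan_bound] become tight: majorization makes adjacency equal to
    having different colours, and each linearized square confines its class to a balanced size. *)
Lemma turan_bound_eq (G : sgraph) r (A : {set G}) : 0 < r ->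
  clique_free_in r.+1 A -> degree_sum A = (turan_number r #|A|).*2 ->
  exists c : G -> nat,
    [/\ forall x, x \in A -> c x < r,
        {in A &, forall x y, adj x y = (c x != c y)}
      & forall k, k < r -> #|A| %/ r <= #|[set y in A | c y == k]| <= (#|A| %/ r).+1].
Proof.
move=> r0 /erdos_majorization[c [cr cm ce]] dsE.
have T := turan_number_double #|A| r0.
have S1 := sum_class_size cr; have S2 := sum_class_size_sqr cr.
have D : degree_sum A + \sum_(x in A) #|[set y in A | c y == c x]| <= #|A| * #|A|.
  by rewrite -big_split /= -sum_nat_const leq_sum.
set q := #|A| %/ r in T *.
have Q : (q.*2 + 1) * #|A| <=
    \sum_(k < r) #|[set y in A | c y == k]| ^ 2 + r * (q * q.+1).
  rewrite -[in X in X <= _]S1 -[r in r * (q * _)]card_ord -sum_nat_const -big_split /=.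
  by rewrite big_distrr /= leq_sum // => k _; apply: leqif_sqr_consecutive.
have E1 : degree_sum A + \sum_(x in A) #|[set y in A | c y == c x]| = #|A| * #|A| by lia.
have E2 : (q.*2 + 1) * #|A| =
    \sum_(k < r) #|[set y in A | c y == k]| ^ 2 + r * (q * q.+1) by lia.
exists c; split=> //.
  apply: ce => x xA; move: E1.
  rewrite -big_split /= -sum_nat_const => /eqP.
  have := leqif_sum (fun x (xA : x \in A) => leqif_eq (cm x xA)).
  by case=> _ -> /forall_inP/(_ x xA)/eqP.
move=> k kr; move: E2.
rewrite -[in X in X = _]S1 -[r in r * (q * _)]card_ord -sum_nat_const -big_split /=.
rewrite big_distrr /= => /eqP.
have := leqif_sum (fun (k : 'I_r) (_ : true) =>
  leqif_sqr_consecutive #|[set y in A | c y == k]| q).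
by case=> _ -> /forall_inP/(_ (Ordinal kr) isT).
Qed.

Lemma card_residue r n k : k < r ->
  #|[set x : 'I_n | x %% r == k]| = n %/ r + (k < n %% r).
Proof.
move=> kr; have r0 : 0 < r by lia.
rewrite -sum1dep_card big_mkcond /=.
elim: n => [|n IH]; first by rewrite big_ord0 div0n mod0n.
rewrite big_ord_recr /= IH; case: (divn_modnS n r0) => [[E1 [-> ->]]|[E1 [-> ->]]];
  have := ltn_pmod n r0; case: eqP; lia.
Qed.

Lemma degree_multipartite (V : finType) (I : eqType) (part : V -> I)
    (x : multipartite part) :
  degree x + #|[set y : V | part y == part x]| = #|V|.
Proof.
rewrite -cardsT -(cardsID [set y : V | part y != part x] setT) setTI; congr (_ + _).
  by apply: eq_card => y; rewrite !inE /adj /= /part_adj eq_sym.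
by apply: eq_card => y; rewrite !inE negbK ?andbT.
Qed.

Lemma nedges_multipartite (V : finType) (I : eqType) (part : V -> I) :
  (nedges (multipartite part)).*2 +
  \sum_x #|[set y : V | part y == part x]| = #|V| ^ 2.
Proof.
rewrite handshake -big_split /= -mulnn -sum_nat_const.
by apply: eq_bigr => x _; rewrite degree_multipartite.
Qed.

Lemma nedges_turan r n : 0 < r -> nedges (turan r n) = turan_number r n.
Proof.
move=> r0; have := nedges_multipartite (fun i : 'I_n => i %% r).
have := turan_number_double n r0.
rewrite card_ord -/(turan r n).
have cr (x : 'I_n) : x \in [set: 'I_n] -> x %% r < r by move=> _; apply: ltn_pmod.
have := sum_class_size_sqr cr.
have EA k : [set y in [set: 'I_n] | y %% r == k] = [set y : 'I_n | y %% r == k].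
  by apply/setP => y; rewrite !inE.
under eq_bigr do rewrite EA.
rewrite (eq_bigl xpredT) => [->|x]; last by rewrite inE.
set q := n %/ r.
have -> : \sum_(k < r) #|[set y in [set: 'I_n] | y %% r == k]| ^ 2 =
   (q.*2 + 1) * n - r * (q * q.+1).
  suff : (q.*2 + 1) * n = \sum_(k < r) #|[set y in [set: 'I_n] | y %% r == k]| ^ 2
     + r * (q * q.+1) by lia.
  rewrite -[in X in X = _](card_ord n) -cardsT -(sum_class_size cr).
  rewrite -[r in r * (q * _)]card_ord -sum_nat_const -big_split /= big_distrr /=.
  by apply: eq_bigr => k _; rewrite EA card_residue // -/q; case: (_ < _); lia.
rewrite -!mulnn; lia.
Qed.

(** * Isomorphisms between complete multipartite graphs *)

(** The j-th element of a colour class goes to the j-th element of the class of the same colour. *)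
Lemma class_bijection (V W : finType) (K : eqType) (c : V -> K) (d : W -> K) :
  (forall k, #|[set x | c x == k]| = #|[set y | d y == k]|) ->
  exists2 f : V -> W, bijective f & forall x, d (f x) = c x.
Proof.
move=> cd.
have pos x : 0 < #|[set y | d y == c x]|.
  by rewrite -cd; apply/card_gt0P; exists x; rewrite inE.
have posW y : 0 < #|[set x | c x == d y]|.
  by rewrite cd; apply/card_gt0P; exists y; rewrite inE.
case: (pickP (fun _ : W => true)) => [w0 _|W0]; last first.
  have V0 (x : V) : False by have /card_gt0P[y _] := pos x; have := W0 y.
  have W0' (y : W) : False by have := W0 y.
  by exists (fun x => match V0 x with end) => [|x]; [exists (fun y => match W0' y with end)
     => x; [case: (V0 x)|case: (W0' x)]|case: (V0 x)].
have /card_gt0P[v0 _] := posW w0.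
pose f x := nth w0 (enum [set y | d y == c x]) (index x (enum [set z | c z == c x])).
pose g y := nth v0 (enum [set x | c x == d y]) (index y (enum [set z | d z == d y])).
have ltf x : index x (enum [set z | c z == c x]) < size (enum [set y | d y == c x]).
  by rewrite -cardE -cd cardE index_mem mem_enum inE.
have ltg y : index y (enum [set z | d z == d y]) < size (enum [set x | c x == d y]).
  by rewrite -cardE cd cardE index_mem mem_enum inE.
have df x : d (f x) = c x.
  by have := mem_nth w0 (ltf x); rewrite mem_enum inE => /eqP.
have cg y : c (g y) = d y.
  by have := mem_nth v0 (ltg y); rewrite mem_enum inE => /eqP.
exists f => //; exists g => [x|y].
  rewrite /g df /f index_uniq ?enum_uniq //.
  by rewrite nth_index // mem_enum inE.
rewrite /f cg /g index_uniq ?enum_uniq //.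
by rewrite nth_index // mem_enum inE.
Qed.

Lemma iso_sym (G H : sgraph) : iso G H -> iso H G.
Proof.
case=> f [g gK fK] fE; exists g; first by exists f.
by move=> x y; rewrite -fE !fK.
Qed.

Lemma iso_trans (G H I : sgraph) : iso G H -> iso H I -> iso G I.
Proof.
move=> [f bf fE] [g bg gE]; exists (g \o f); first exact: bij_comp.
by move=> x y /=; rewrite gE fE.
Qed.

Lemma iso_nedges (G H : sgraph) : iso G H -> nedges G = nedges H.
Proof.
case=> f bf fE; apply: double_inj; rewrite !handshake.
rewrite [RHS](reindex f) /=; last by case: bf => g ? ?; exists g => x _.
apply: eq_bigr => x _; rewrite /degree -(card_imset _ (bij_inj bf)).
apply: eq_card => y; case: bf => g gK fK.
rewrite inE -[y]fK mem_imset ?inE ?fE //.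
exact: can_inj gK.
Qed.

(** Empty colours are invisible in the graph, hence s > 0 and the restriction to nonempty classes.
    [class_bijection] is used twice: to match colours by class size, then vertices along that
    matching. *)
Lemma iso_multipartite (V W K L : finType) (c : V -> K) (d : W -> L) :
  (forall s, 0 < s -> #|[set k | #|[set x | c x == k]| == s]| =
                      #|[set l | #|[set y | d y == l]| == s]|) ->
  iso (multipartite c) (multipartite d).
Proof.
move=> cd.
pose sc k := #|[set x | c x == k]|; pose sd l := #|[set y | d y == l]|.
pose K' := {k | 0 < sc k}; pose L' := {l | 0 < sd l}.
have cP x : 0 < sc (c x) by apply/card_gt0P; exists x; rewrite inE.
have dP y : 0 < sd (d y) by apply/card_gt0P; exists y; rewrite inE.
pose c' x : K' := exist _ (c x) (cP x); pose d' y : L' := exist _ (d y) (dP y).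
have [s|f [g gK fK] fE] := @class_bijection K' L' _ (sc \o val) (sd \o val).
  case: (posnP s) => [->|s0].
    by rewrite !eq_card0 // => -[x p]; rewrite inE /= (gtn_eqF p).
  rewrite -(card_imset _ val_inj) -[RHS](card_imset _ val_inj).
  have -> : val @: [set x : K' | (sc \o val) x == s] = [set k | sc k == s].
    apply/setP => k; rewrite inE; apply/imsetP/idP => [[x + ->]|ks]; first by rewrite inE.
    have k0 : 0 < sc k by rewrite (eqP ks).
    by exists (exist _ k k0); rewrite ?inE.
  have -> : val @: [set x : L' | (sd \o val) x == s] = [set l | sd l == s].
    apply/setP => k; rewrite inE; apply/imsetP/idP => [[x + ->]|ks]; first by rewrite inE.
    have k0 : 0 < sd k by rewrite (eqP ks).
    by exists (exist _ k k0); rewrite ?inE.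
  exact: cd.
have [l|h bh hE] := @class_bijection V W _ (f \o c') d'.
  transitivity (sc (val (g l))).
    apply: eq_card => x; rewrite !inE /=.
    by rewrite -{1}[l]fK (can_eq gK) -val_eqE.
  have /= -> := esym (fE (g l)); rewrite fK.
  by apply: eq_card => y; rewrite !inE.
exists h => // x y; rewrite /adj /= /part_adj.
have -> : (d (h x) == d (h y)) = (d' (h x) == d' (h y)) by rewrite -val_eqE.
by rewrite !hE /= (can_eq gK) -val_eqE.
Qed.

Lemma iso_colored (G : sgraph) r (c : G -> 'I_r) :
  (forall x y, adj x y = (c x != c y)) -> iso G (multipartite c).
Proof. by move=> cE; exists id; [exists id|move=> x y; rewrite cE]. Qed.

Lemma card_balanced (K L : finType) (s : K -> nat) (t : L -> nat) q :
  #|K| = #|L| -> (forall k, q <= s k <= q.+1) -> (forall l, q <= t l <= q.+1) ->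
  \sum_k s k = \sum_l t l ->
  forall m, #|[set k | s k == m]| = #|[set l | t l == m]|.
Proof.
move=> KL sq tq st m.
have count (J : finType) (u : J -> nat) : (forall j, q <= u j <= q.+1) ->
    #|[set j | u j == m]| =
    (m == q) * (#|J| - (\sum_j u j - #|J| * q)) + (m == q.+1) * (\sum_j u j - #|J| * q).
  move=> uq.
  have -> : \sum_j u j - #|J| * q = \sum_j (u j == q.+1).
    have -> : \sum_j u j = #|J| * q + \sum_j (u j == q.+1).
      rewrite -sum_nat_const -big_split /=; apply: eq_bigr => j _.
      by have := uq j; case: eqP; lia.
    lia.
  have -> : #|J| = \sum_j (u j == q) + \sum_j (u j == q.+1).
    rewrite -sum1_card -big_split /=; apply: eq_bigr => j _.
    by have := uq j; case: eqP; case: eqP; lia.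
  rewrite addnK -sum1dep_card big_mkcond /=.
  rewrite !big_distrr -big_split /=; apply: eq_bigr => j _.
  by have := uq j; do ![case: eqP]; lia.
by rewrite !count // KL st.
Qed.

Lemma iso_turan (G : sgraph) r (c : G -> nat) : 0 < r ->
  (forall x, c x < r) -> (forall x y, adj x y = (c x != c y)) ->
  (forall k, k < r -> #|G| %/ r <= #|[set y | c y == k]| <= (#|G| %/ r).+1) ->
  iso G (turan r #|G|).
Proof.
move=> r0 cr cE csz.
pose c' x : 'I_r := Ordinal (cr x).
have H1 : iso G (multipartite c').
  by apply: iso_colored => x y; rewrite cE -val_eqE.
apply: iso_trans H1 _.
pose d (i : 'I_(#|G|)) : 'I_r := Ordinal (ltn_pmod i r0).
have H2 : iso (multipartite d) (turan r #|G|).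
  by exists id; [exists id|move=> x y; rewrite /adj /= /part_adj -val_eqE].
apply: iso_trans H2; apply: iso_multipartite => s _.
have S1 k : #|[set x | c' x == k]| = #|[set y | c y == k]|.
  by apply: eq_card => y; rewrite !inE -val_eqE.
have S2 k : #|[set x | d x == k]| = #|G| %/ r + (k < #|G| %% r).
  rewrite -(card_residue #|G| (ltn_ord k)).
  by apply: eq_card => y; rewrite !inE -val_eqE.
apply: (@card_balanced _ _ _ _ (#|G| %/ r)) => // [k|k|].
- by rewrite S1; apply: csz.
- by rewrite S2; case: (_ < _); lia.
have cr' x : x \in [set: G] -> c x < r by [].
have dr' (x : 'I_#|G|) : x \in [set: 'I_#|G|] -> d x < r by [].
transitivity #|[set: G]|.
  rewrite -(sum_class_size cr'); apply: eq_bigr => k _; rewrite S1.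
  by apply: eq_card => y; rewrite !inE.
have -> : #|[set: G]| = #|[set: 'I_#|G|]| by rewrite !cardsT card_ord.
rewrite -(sum_class_size dr'); apply: eq_bigr => k _.
by apply: eq_card => y; rewrite !inE.
Qed.

(** * Counting after vertex deletion *)

Lemma card_del_set (G : sgraph) (S : {set G}) (P : pred G) :
  #|[set x : del S | P (val x)]| = #|[set y in ~: S | P y]|.
Proof.
rewrite -(card_imset _ val_inj); apply: eq_card => y; rewrite !inE.
apply/imsetP/andP => [[[x xS]]|[yS Py]]; first by rewrite inE /= => Px ->.
by exists (exist _ y yS); rewrite ?inE.
Qed.

Lemma card_del (G : sgraph) (S : {set G}) : #|del S| = #|G| - #|S|.
Proof.
have -> : #|del S| = #|[set x : del S | predT (val x)]|.
  by rewrite -cardsT; apply: eq_card => x; rewrite !inE.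
rewrite card_del_set -(cardsC S).
suff -> : [set y in ~: S | predT y] = ~: S by rewrite addKn.
by apply/setP => y; rewrite !inE andbT.
Qed.

Lemma degree_del (G : sgraph) (S : {set G}) (x : del S) :
  degree x = degree_in (~: S) (val x).
Proof. exact: card_del_set. Qed.

Lemma degree_sum_del (G : sgraph) (S : {set G}) :
  degree_sum (~: S) = (nedges (del S)).*2.
Proof.
rewrite handshake; under [RHS]eq_bigr do rewrite degree_del.
rewrite /degree_sum; transitivity (\sum_(y in [set val x | x : del S]) degree_in (~: S) y).
  apply: eq_bigl => y; rewrite inE.
  by apply/idP/imsetP => [yS|[[x xS] _ ->]] //; exists (exist _ y yS).
by rewrite big_imset //= => x y _ _; apply: val_inj.
Qed.

(** * Ore's lemma and Chvátal's degree condition *)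

Section Closure.
Variable V : finType.
Implicit Types (e : rel V) (u v x y : V) (c p : seq V).

(** Bare relations are used here, so that edges can be added and the vertex type extended by an apex
    without rebuilding a graph. *)
Definition rdegree e x := #|[set y | e x y]|.

Definition add_edge e u v : rel V :=
  fun x y => [|| e x y, (x == u) && (y == v) | (x == v) && (y == u)].

Definition spanning_cycle e c := [/\ 2 < size c, ucycle e c & forall z, z \in c].

Lemma add_edge_sym e u v : symmetric e -> symmetric (add_edge e u v).
Proof.
move=> se x y; rewrite /add_edge se; congr (_ || _).
by rewrite orbC [(y == u) && _]andbC [(y == v) && _]andbC.
Qed.

Lemma rev_cycle_sym e c : symmetric e -> cycle e (rev c) = cycle e c.
Proof.
by move=> se; rewrite rev_cycle; apply: eq_cycle => x y; rewrite se.
Qed.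

(** Rotate the cycle to start at [u]. If [v] is next to [u] on it, cutting there leaves a
    Hamiltonian path of [e], reversed when [v] comes first; otherwise the added edge is not on the
    cycle. *)
Lemma spanning_cycle_split e u v c : symmetric e -> u != v ->
  spanning_cycle (add_edge e u v) c ->
  (exists c', spanning_cycle e c') \/
  exists p, [/\ path e u p, last u p = v, uniq (u :: p) & forall z, z \in u :: p].
Proof.
move=> se uv [sz /andP[cyc un] span].
set E := add_edge e u v in cyc.
have sE : symmetric E by apply: add_edge_sym.
have [i p rp] := rot_to (span u).
have {cyc}cyc : path E u (rcons p u) by move: cyc; rewrite -(rot_cycle i) rp.
have {un}un : uniq (u :: p) by rewrite -rp rot_uniq.
have {sz}sz : 2 < size (u :: p) by rewrite -rp size_rot.
have {span rp}span z : z \in u :: p by rewrite -rp mem_rot.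
have subE w : w = u \/ w = v -> forall a b, a != w -> b != w -> E a b -> e a b.
  by case=> -> a b /negPf na /negPf nb; rewrite /E /add_edge na nb ?andbF /= ?orbF.
have sub_path w : w = u \/ w = v -> forall a s, w \notin a :: s -> path E a s -> path e a s.
  move=> wuv a s wn; apply: (@sub_in_path _ (predC1 w)) => [b d /= nb nd|].
    exact: (subE w).
  by apply/allP => b bs; apply: contraNneq wn => <-.
(* Here [v] comes last and, with at least three vertices, is entered from a vertex other than [u];
   the added edge can only be the closing one. *)
have case_last q : path E u (rcons q u) -> uniq (u :: q) -> 2 < size (u :: q) ->
    last u q = v -> path e u q.
  case/lastP: q => [//|q b]; rewrite last_rcons => + + + bv; rewrite {b}bv.
  rewrite rcons_path => /andP[+ _] unq szq; rewrite !rcons_path => /andP[pq ql].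
  have vn : v \notin u :: q.
    by move: unq; rewrite -rcons_cons rcons_uniq => /andP[].
  apply/andP; split; first by apply: (sub_path v) => //; right.
  case/lastP: q szq vn pq ql unq => [//|q b] _ vn _; rewrite last_rcons => ql unq.
  have bu : b != u.
    by move: unq; apply: contraTneq => ->; rewrite /= mem_rcons inE mem_rcons inE eqxx orbT.
  have bv : b != v by apply: contraNneq vn => <-; rewrite inE mem_rcons inE eqxx orbT.
  move: ql; rewrite /E /add_edge (negPf bu) (negPf bv) /= orbF.
  by [].
case: (eqVneq (last u p) v) => [lv|nlv].
  by right; exists p; split=> //; apply: case_last.
case: p cyc un sz span nlv => [//|a p] cyc un sz span nlv.
case: (eqVneq a v) => [av|nav].
  right; exists (rev (a :: p)); have L : last u (rev (a :: p)) = v.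
    by rewrite rev_cons last_rcons.
  split=> //; last 2 first.
  - by move: un; rewrite /= mem_rev rev_uniq.
  - by move=> z; have := span z; rewrite !(inE, mem_rev).
  apply: case_last => //; last 2 first.
  - by move: un; rewrite /= mem_rev rev_uniq.
  - by rewrite /= size_rev.
  have : cycle E (rev (u :: a :: p)) by rewrite rev_cycle_sym.
  by rewrite [rev (u :: _)]rev_cons -[X in cycle E X]rot1_cons rot_cycle.
left; exists (u :: a :: p); split=> //; apply/andP; split=> //.
move: cyc; rewrite /= !rcons_path => /and3P[ua pa pl].
have una : u \notin a :: p by case/andP: un.
apply/and3P; split.
- have nau : a != u by apply: contraNneq una => ->; rewrite inE eqxx.
  move: ua; rewrite /E /add_edge (negPf nav) (negPf nau) !andbF !orbF.
  by [].
- by apply: (sub_path u) => //; left.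
- have nlu : last a p != u by apply: contraNneq una => <-; rewrite mem_last.
  move: pl; rewrite /E /add_edge (negPf nlu) /=; rewrite /= in nlv.
  by rewrite (negPf nlv) /= orbF.
Qed.

(** Crossing argument: on a Hamiltonian path from [u] to [v], a degree sum of at least n yields
    consecutive vertices, the first adjacent to [v] and the second to [u]. *)
Lemma ore e u v : symmetric e -> irreflexive e -> u != v ->
  (exists c, spanning_cycle (add_edge e u v) c) ->
  ~ (exists c, spanning_cycle e c) ->
  rdegree e u + rdegree e v < #|V|.
Proof.
move=> se ie uv [c cE] ncyc.
have sz : 2 < #|V|.
  case: cE => s2 /andP[_ un] span; apply: (leq_trans s2).
  by rewrite -(card_uniqP un) max_card.
case: (spanning_cycle_split se uv cE) => [//|[p [pp lp un span]]].
rewrite ltnNge; apply/negP => big; apply: ncyc.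
have szp : (size p).+1 = #|V|.
  by rewrite -[LHS](card_uniqP un); apply: eq_card => z; rewrite span.
have unp : uniq p by case/andP: un.
(* Index [i] is the path edge from [nth u (u :: p) i] to [nth u p i]. [A] holds the edges whose head
   is adjacent to [u], [B] those whose tail is adjacent to [v]; there are only n - 1 path edges. *)
pose A := [set i : 'I_(size p) | e u (nth u p i)].
pose B := [set i : 'I_(size p) | e v (nth u (u :: p) i)].
have cA : rdegree e u <= #|A|.
  rewrite -(@card_in_imset _ _ (fun i : 'I_(size p) => nth u p i) A); last first.
    by move=> i j _ _ /eqP; rewrite nth_uniq // => /eqP/val_inj.
  apply: subset_leq_card; apply/subsetP => y; rewrite inE => uy; apply/imsetP.
  have yp : y \in p.
    have := span y; rewrite inE => /orP[/eqP yu|//]; by rewrite yu ie in uy.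
  have ilt : index y p < size p by rewrite index_mem.
  by exists (Ordinal ilt); rewrite ?inE /= nth_index.
have cB : rdegree e v <= #|B|.
  rewrite -(@card_in_imset _ _ (fun i : 'I_(size p) => nth u (u :: p) i) B); last first.
    move=> i j _ _ /eqP; rewrite nth_uniq //= ?ltnS; try exact: ltnW.
    by move=> /eqP/val_inj.
  apply: subset_leq_card; apply/subsetP => y; rewrite inE => vy; apply/imsetP.
  have ilt : index y (u :: p) < size p.
    have : index y (u :: p) < size (u :: p) by rewrite index_mem.
    rewrite /= ltnS leq_eqVlt => /orP[/eqP E|//].
    have : y = v.
      have : last u (u :: p) = y by rewrite -nth_last [_.-1]/= -E nth_index.
      by rewrite /= lp.
    by move=> yv; rewrite yv ie in vy.
  by exists (Ordinal ilt); rewrite ?inE /= nth_index.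
have /set0Pn[i] : A :&: B != set0.
  have U : #|A :|: B| <= size p by rewrite -[X in _ <= X]card_ord max_card.
  by rewrite -card_gt0; have := cardsUI A B; lia.
rewrite !inE => /andP[ui vi].
have ilt := ltn_ord i.
have [y [t Ed]] : exists y t, drop i p = y :: t.
  by exists (nth u p i), (drop i.+1 p); apply: drop_nth.
have Ey : y = nth u p i by have := drop_nth u ilt; rewrite Ed => -[].
move: (pp) lp; rewrite -{1 2}(cat_take_drop i p) Ed cat_path last_cat /=.
have El : last u (take i p) = nth u (u :: p) i.
  rewrite (last_nth u) size_takel ?(ltnW ilt) //.
  by case: (val i) => //= j; rewrite nth_take.
rewrite El => /andP[pt /andP[_ pyt]] lyt.
(* Walk from [u] to the tail of the edge, jump to [v], walk back to its head, close up at [u]. *)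
exists (u :: take i p ++ rev (y :: t)).
have PE : perm_eq (u :: p) (u :: take i p ++ rev (y :: t)).
  by rewrite perm_cons -{1}(cat_take_drop i p) Ed perm_cat2l perm_sym perm_rev.
split.
- by rewrite -(perm_size PE) /= szp.
- apply/andP; split; last by rewrite -(perm_uniq PE).
  rewrite /= rcons_cat cat_path pt El /= -rev_cons.
  have -> : path e (nth u (u :: p) i) (rev (u :: y :: t)) =
            path (fun z => e^~ z) u (rcons (y :: t) (nth u (u :: p) i)).
    have := rev_path e u (rcons (y :: t) (nth u (u :: p) i)).
    by rewrite last_rcons belast_rcons.
  rewrite (eq_path (e' := e)); last by move=> a b; rewrite se.
  by rewrite /= rcons_path pyt lyt vi Ey ui.
- by move=> z; rewrite -(perm_mem PE).
Qed.

(** Chvátal's failure condition, shifted by [m]. Of the case i = 1 only one vertex of degree at most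
    [m] is kept, since it alone gives the edge bound. *)
Definition low_degrees m e :=
  (exists v, rdegree e v <= m) \/
  exists i, [/\ 1 < i, i.*2 + m <= #|V|, i <= #|[set x | rdegree e x < i + m]|
              & #|V| < i + m + #|[set x | rdegree e x < #|V| - i]|].

Lemma low_degrees_mono m e e' : subrel e e' -> low_degrees m e' -> low_degrees m e.
Proof.
move=> sub; have le x : rdegree e x <= rdegree e' x.
  by apply: subset_leq_card; apply/subsetP => y; rewrite !inE; apply: sub.
have leS k : #|[set x | rdegree e' x < k]| <= #|[set x | rdegree e x < k]|.
  by apply: subset_leq_card; apply/subsetP => x; rewrite !inE; have := le x; lia.
case=> [[v dv]|[i [i1 i2 i3 i4]]]; [left; exists v|right; exists i; split] => //.
- exact: leq_trans (le v) dv.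
- exact: leq_trans i3 (leS _).
- by apply: leq_trans i4 _; rewrite leq_add2l leS.
Qed.

(* Chvátal's argument: in an edge-maximal counterexample, a non-adjacent pair with
   the largest degree sum forces the degree sequence to be low. *)
Lemma chvatal m (P : rel V -> Prop) :
  (forall e, symmetric e -> (forall x y, x != y -> e x y) -> P e) ->
  (forall e u v, symmetric e -> irreflexive e -> ~ P e -> u != v -> ~~ e u v ->
     P (add_edge e u v) -> rdegree e u + rdegree e v + 2 <= #|V| + m) ->
  forall e, symmetric e -> irreflexive e -> ~ P e -> low_degrees m e.
Proof.
move=> Pfull Pore e.
have [k] := ubnP #|[set p : V * V | ~~ e p.1 p.2]|.
elim: k e => // k IH e lek se ie nP.
case: (classic (exists u v, [/\ u != v, ~~ e u v & ~ P (add_edge e u v)])) =>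
    [[u [v [uv nuv nPuv]]]|maxP].
  have sub : subrel e (add_edge e u v) by move=> x y xy; rewrite /add_edge xy.
  apply: (low_degrees_mono sub); apply: IH => //.
  - rewrite ltnS in lek; apply: leq_trans lek; apply: proper_card; apply/properP; split.
      by apply/subsetP => p; rewrite !inE; apply: contra; apply: sub.
    by exists (u, v); rewrite !inE //= /add_edge !eqxx !orbT.
  - exact: add_edge_sym.
  - move=> x; rewrite /add_edge ie /=; apply/negbTE; rewrite negb_or.
    by apply/andP; split; apply: contraNN uv => /andP[/eqP<- /eqP<-].
have {maxP}Psum x y : x != y -> ~~ e x y -> rdegree e x + rdegree e y + 2 <= #|V| + m.
  move=> xy nxy; apply: Pore => //; apply: NNPP => nPxy.
  by apply: maxP; exists x, y.
pose Q := [pred p : V * V | (p.1 != p.2) && ~~ e p.1 p.2].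
case: (pickP Q) => [p0 Qp0|Q0]; last first.
  case: nP; apply: Pfull => // x y xy; apply/negPn/negP => nxy.
  by have := Q0 (x, y); rewrite /= xy nxy.
pose p := [arg max_(p > p0 | Q p) (rdegree e p.1 + rdegree e p.2)].
have [Qp maxp] : Q p /\ forall q, Q q ->
    rdegree e q.1 + rdegree e q.2 <= rdegree e p.1 + rdegree e p.2.
  by rewrite /p; case: arg_maxnP.
have [u [v [uv nuv maxuv leuv]]] : exists u v, [/\ u != v, ~~ e u v,
    forall x y, x != y -> ~~ e x y -> rdegree e x + rdegree e y <= rdegree e u + rdegree e v
    & rdegree e u <= rdegree e v].
  have /andP[p12 np] := Qp.
  have M x y : x != y -> ~~ e x y -> rdegree e x + rdegree e y <= rdegree e p.1 + rdegree e p.2.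
    by move=> xy nxy; apply: (maxp (x, y)); rewrite /= xy nxy.
  case: (leqP (rdegree e p.1) (rdegree e p.2)) => h.
    by exists p.1, p.2.
  exists p.2, p.1; rewrite eq_sym se; split=> // [x y xy nxy|]; last exact: ltnW.
  by rewrite addnC [X in _ <= X]addnC [X in X <= _]addnC M.
have Duv := Psum u v uv nuv.
have nonnbr x : #|[set y | (y != x) && ~~ e x y]| + rdegree e x + 1 = #|V|.
  have := cardsC [set y | e x y]; rewrite -/(rdegree e x).
  rewrite [#|~: _|](cardsD1 x) !inE ie /=.
  have -> : (~: [set y | e x y]) :\ x = [set y | (y != x) && ~~ e x y].
    by apply/setP => y; rewrite !inE.
  lia.
case: (leqP (rdegree e u) m) => um; first by left; exists u.
(* Take i = d(u) + 1 - m. By maximality the non-neighbours of [v] have degree at most d(u) = i + m -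
   1, and [Duv] makes at least i of them. With its non-neighbours, [u] forms a set of n + 1 - i - m
   vertices of degree at most d(v) < n - i. *)
right; exists (rdegree e u + 1 - m); split; [lia|lia| |].
- apply: (@leq_trans #|[set y | (y != v) && ~~ e v y]|).
    by have := nonnbr v; lia.
  apply: subset_leq_card; apply/subsetP => y; rewrite !inE => /andP[yv nvy].
  by have := maxuv y v yv; rewrite se nvy => /(_ isT); lia.
- have E : #|u |: [set y | (y != u) && ~~ e u y]| = #|V| - rdegree e u.
    by rewrite cardsU1 !inE eqxx /= -(nonnbr u) -addnA [rdegree e u + 1]addnC addnA addnK addnC.
  have : #|u |: [set y | (y != u) && ~~ e u y]| <=
      #|[set x | rdegree e x < #|V| - (rdegree e u + 1 - m)]|.
    apply: subset_leq_card; apply/subsetP => y; rewrite !inE => /orP[/eqP->|]; first lia.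
    by move=> /andP[yu nuy]; have := maxuv u y; rewrite eq_sym yu nuy => /(_ isT isT); lia.
  rewrite E; lia.
Qed.

End Closure.

Section Apex.
Variables (V : finType) (N : pred V).
Implicit Types (e : rel V) (x y u v : V) (p : seq V).

(* The graph e with an extra vertex None joined to N: its spanning cycles are the
   Hamiltonian paths of e with both ends in N. *)
Definition apex e : rel (option V) := fun a b =>
  match a, b with
  | Some x, Some y => e x y
  | Some x, None => N x
  | None, Some y => N y
  | None, None => false
  end.

Definition spanning_path e x p := [/\ path e x p, uniq (x :: p) & forall z, z \in x :: p].

Lemma apex_sym e : symmetric e -> symmetric (apex e).
Proof. by move=> se [x|] [y|] //=; rewrite se. Qed.

Lemma apex_irrefl e : irreflexive e -> irreflexive (apex e).
Proof. by move=> ie [x|] //=. Qed.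

Lemma path_apex e x p : path (apex e) (Some x) (map Some p) = path e x p.
Proof. by elim: p x => //= y p IH x; rewrite IH. Qed.

Lemma cycle_apex e x p :
  cycle (apex e) (None :: map Some (x :: p)) = [&& N x, path e x p & N (last x p)].
Proof. by rewrite /= rcons_path path_apex last_map. Qed.

Lemma rdegree_apex e x : rdegree (apex e) (Some x) = rdegree e x + N x.
Proof.
rewrite /rdegree (cardsD1 None) inE /= addnC; congr (_ + _).
rewrite -(card_imset _ (@Some_inj _)); apply: eq_card => -[y|]; rewrite !inE /=.
  by rewrite mem_imset ?inE //; apply: Some_inj.
by apply/esym/imsetP => -[].
Qed.

Lemma spanning_cycle_apex e : 1 < #|V| ->
  ((exists c, spanning_cycle (apex e) c) <->
   exists x p, [/\ spanning_path e x p, N x & N (last x p)]).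
Proof.
move=> V1; split=> [[c [sz /andP[cyc un] span]]|[x [p [[pp un span] Nx Nl]]]].
  have [i s rs] := rot_to (span None).
  have [t Et] : exists t, s = map Some t.
    have : None \notin s by move: un; rewrite -(rot_uniq i) rs => /andP[].
    elim: s {rs} => [_|[y|] s IH]; first by exists [::].
      by rewrite inE => /IH[t ->]; exists (y :: t).
    by rewrite inE eqxx.
  move: rs; rewrite {s}Et; case: t => [|x p] rs.
    by move: sz; rewrite -(size_rot i) rs.
  move: cyc; rewrite -(rot_cycle i) rs cycle_apex => /and3P[Nx pp Nl].
  exists x, p; split=> //; split=> // [|z].
    move: un; rewrite -(rot_uniq i) rs cons_uniq => /andP[_].
    by rewrite (map_inj_uniq (@Some_inj _)).
  have := span (Some z); rewrite -(mem_rot i) rs inE.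
  by rewrite orFb (mem_map (@Some_inj _)).
exists (None :: map Some (x :: p)); split.
- have : #|V| <= size (x :: p).
    by rewrite -(card_uniqP un) subset_leq_card //; apply/subsetP => z _; apply: span.
  by rewrite /= size_map; apply: leq_trans V1.
- apply/andP; split; first by rewrite cycle_apex Nx pp Nl.
  rewrite cons_uniq (map_inj_uniq (@Some_inj _)) un andbT.
  by apply/mapP => -[].
- by move=> [z|] //; rewrite inE (mem_map (@Some_inj _)) span orbT.
Qed.

Lemma spanning_cycle_apex_add e u v c :
  spanning_cycle (apex (add_edge e u v)) c ->
  spanning_cycle (add_edge (apex e) (Some u) (Some v)) c.
Proof.
case=> sz /andP[cyc un] span; split=> //; apply/andP; split=> //.
have E : apex (add_edge e u v) =2 add_edge (apex e) (Some u) (Some v).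
  by move=> [x|] [y|] //=; rewrite /add_edge /= ?orbF ?andbF ?orbF.
by rewrite -(eq_cycle E).
Qed.

(** Ore's bound on n + 1 vertices. With [N] = [predT] the apex adds 2 to the degree sum, which gives
    [m] = 0; with two prescribed ends it may add nothing, which gives [m] = 2. Without an apex Ore
    gives [m] = 1. *)
Lemma ore_apex e u v : 1 < #|V| -> symmetric e -> irreflexive e -> u != v ->
  (exists x p, [/\ spanning_path (add_edge e u v) x p, N x & N (last x p)]) ->
  ~ (exists x p, [/\ spanning_path e x p, N x & N (last x p)]) ->
  rdegree e u + rdegree e v + N u + N v <= #|V|.
Proof.
move=> V1 se ie uv /(spanning_cycle_apex _ V1)[c cE] nc.
have := @ore _ (apex e) (Some u) (Some v) (apex_sym se) (apex_irrefl ie).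
rewrite card_option !rdegree_apex ltnS => H.
suff : rdegree e u + N u + (rdegree e v + N v) <= #|V| by lia.
apply: H => //; first by exists c; apply: spanning_cycle_apex_add.
by move=> /(spanning_cycle_apex _ V1).
Qed.

End Apex.

Section Degrees.
Variable V : finType.
Implicit Types (e : rel V) (x y : V) (p s : seq V).

Lemma path_complete e x s : (forall x y, x != y -> e x y) -> uniq (x :: s) -> path e x s.
Proof.
move=> full; elim: s x => //= y s IH x; rewrite inE negb_or => /andP[/andP[xy _] ys].
by rewrite full //= IH.
Qed.

Lemma spanning_cycle_complete e : 2 < #|V| ->
  (forall x y, x != y -> e x y) -> exists c, spanning_cycle e c.
Proof.
move=> V2 full; exists (enum V); split; first by rewrite -cardE.
  apply/andP; split; last exact: enum_uniq.
  have := enum_uniq V; have := V2; rewrite cardE; case: (enum V) => // x [//|y s] _ un.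
  rewrite /cycle rcons_path path_complete //= full //.
  by case/andP: un => xn _; apply: contraNneq xn => <-; rewrite mem_last.
by move=> z; rewrite mem_enum.
Qed.

Lemma spanning_path_complete e : 0 < #|V| ->
  (forall x y, x != y -> e x y) -> exists x p, spanning_path e x p.
Proof.
move=> V0 full; have := enum_uniq V; have := mem_enum V; move: V0; rewrite cardE.
case: (enum V) => // x p _ sp un; exists x, p; split=> //; exact: path_complete.
Qed.

Lemma spanning_path_between_complete e x y : x != y ->
  (forall x y, x != y -> e x y) -> exists2 p, spanning_path e x p & last x p = y.
Proof.
move=> xy full; pose s := enum (predC (pred2 x y)).
have un : uniq (x :: rcons s y).
  by rewrite /= mem_rcons inE rcons_uniq !mem_enum !inE !eqxx ?orbT /= enum_uniq (negPf xy).
exists (rcons s y); last by rewrite last_rcons.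
split=> //; first exact: path_complete.
by move=> z; rewrite inE mem_rcons inE mem_enum !inE; case: (z == x); case: (z == y).
Qed.

Lemma spanning_path_rev e x p : symmetric e -> spanning_path e x p ->
  exists2 q, spanning_path e (last x p) q & last (last x p) q = x.
Proof.
move=> se [pp un span]; exists (rev (belast x p)); last first.
  by case: p {pp un span} => //= y p; rewrite rev_cons last_rcons.
have R : last x p :: rev (belast x p) = rev (x :: p).
  by rewrite (lastI x p) rev_rcons.
split; rewrite ?R ?rev_uniq //; last by move=> z; rewrite mem_rev.
by rewrite rev_path; rewrite (eq_path (e' := e)) // => a b; rewrite se.
Qed.

Lemma spanning_path_between e x y : symmetric e -> x != y ->
  (exists z p, [/\ spanning_path e z p, pred2 x y z & pred2 x y (last z p)]) ->
  exists2 p, spanning_path e x p & last x p = y.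
Proof.
move=> se xy [z [p [sp zxy lxy]]].
have nzl : z != last z p.
  case: sp => _; case: p lxy => [|w p] lxy un span; last first.
    by case/andP: un => zn _; apply: contraNneq zn => E; rewrite [X in X \in _]E /= mem_last.
  by have := span x; have := span y; rewrite !inE => /eqP E1 /eqP E2; rewrite E1 E2 eqxx in xy.
case/orP: zxy => /eqP E; case/orP: lxy => /eqP L.
- by rewrite L E eqxx in nzl.
- by exists p; rewrite -E.
- by have [q] := spanning_path_rev se sp; rewrite L E; exists q.
- by rewrite L E eqxx in nzl.
Qed.

End Degrees.

Definition low m (G : sgraph) := low_degrees m (@adj G).

(** Disposes of the orders too small for [chvatal] or the apex lemma: any vertex is low there. *)
Lemma low_small (G : sgraph) m : 0 < #|G| <= m.+1 -> low m G.
Proof.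
by move=> /andP[/card_gt0P[x _] le]; left; exists x; have := degree_lt_card x;
  rewrite -[rdegree _ _]/(degree x); lia.
Qed.

Lemma not_hamiltonian_low (G : sgraph) : 0 < #|G| -> ~ hamiltonian G -> low 1 G.
Proof.
move=> G0 nH; case: (leqP #|G| 2) => G2; first by apply: low_small; rewrite G0.
apply: (@chvatal _ 1 (fun e => exists c, spanning_cycle e c)) => //.
- by move=> e _; apply: spanning_cycle_complete.
- move=> e u v se ie nPe uv _ Pe; have := ore se ie uv Pe nPe; lia.
- exact: adj_sym.
- exact: adj_irrefl.
Qed.

Lemma not_traceable_low (G : sgraph) : 0 < #|G| -> ~ traceable G -> low 0 G.
Proof.
move=> G0 nT; case: (leqP #|G| 1) => G1; first by apply: low_small; rewrite G0.
apply: (@chvatal _ 0 (fun e => exists x p, spanning_path e x p)) => //.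
- by move=> e _; apply: spanning_path_complete.
- move=> e u v se ie nPe uv _ [x [p Pe]].
  have : rdegree e u + rdegree e v + 1 + 1 <= #|G|.
    apply: (@ore_apex _ predT e u v) => //; first by exists x, p.
    by move=> [y [q [Pq _ _]]]; apply: nPe; exists y, q.
  lia.
- exact: adj_sym.
- exact: adj_irrefl.
Qed.

Lemma not_ham_connected_low (G : sgraph) : 0 < #|G| -> ~ ham_connected G -> low 2 G.
Proof.
move=> G0 nH; case: (leqP #|G| 3) => G3; first by apply: low_small; rewrite G0.
have [x [y [xy nP]]] : exists x y : G, x != y /\
    ~ (exists2 p, spanning_path (@adj G) x p & last x p = y).
  apply: NNPP => H; apply: nH => x y xy; apply: NNPP => nP.
  by apply: H; exists x, y.
apply: (@chvatal _ 2 (fun e => exists2 p, spanning_path e x p & last x p = y)) => //.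
- by move=> e _; apply: spanning_path_between_complete.
- move=> e u v se ie nPe uv _ [p Pe lp].
  have : rdegree e u + rdegree e v + (pred2 x y u) + (pred2 x y v) <= #|G|.
    apply: (@ore_apex _ (pred2 x y) e u v) => //; first exact: ltn_trans G3.
      by exists x, p; rewrite lp /= !eqxx orbT.
    by move/(spanning_path_between se xy).
  lia.
- exact: adj_sym.
- exact: adj_irrefl.
Qed.

(** Restoring [S] raises degrees by at most [#|S|] and the order by exactly [#|S|]; with the same i,
    every inequality survives the shift of [m] by [#|S|]. *)
Lemma low_del (G : sgraph) (S : {set G}) m : low m (del S) -> low (m + #|S|) G.
Proof.
have dS (x : del S) : degree (val x) <= degree x + #|S|.
  rewrite degree_del (degree_inC S) addnC leq_add2l; exact: degree_in_le.
have cS : #|S| <= #|G| by exact: max_card.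
have cardS (P : pred nat) (Q : pred nat) :
    (forall x : del S, P (degree x) -> Q (degree (val x))) ->
    #|[set x : del S | P (degree x)]| <= #|[set x : G | Q (degree x)]|.
  move=> PQ; rewrite -(card_imset _ val_inj); apply: subset_leq_card.
  by apply/subsetP => _ /imsetP[x + ->]; rewrite !inE; apply: PQ.
case=> [[v dv]|[i []]].
  left; exists (val v); apply: leq_trans (dS v) _.
  by rewrite leq_add2r.
rewrite card_del => i1 i2 i3 i4; right; exists i; split=> //.
- lia.
- apply: leq_trans i3 _; apply: (cardS (fun d => d < i + m) (fun d => d < i + (m + #|S|))).
  by move=> x; have := dS x; lia.
- have : #|[set x : del S | rdegree adj x < #|G| - #|S| - i]| <=
         #|[set x : G | rdegree adj x < #|G| - i]|.
    apply: (cardS (fun d => d < #|G| - #|S| - i) (fun d => d < #|G| - i)).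
    by move=> x; have := dS x; lia.
  lia.
Qed.

(** Take i to be the order of a component with at most half of the vertices: its vertices have
    degree below i, and all vertices have degree below n - i. *)
Lemma not_connected_low (G : sgraph) : ~ connected G -> low 0 G.
Proof.
move=> nC.
have csym : connect_sym (@adj G) by apply: sym_connect_sym; apply: adj_sym.
have [x [y nxy]] : exists x y : G, ~~ connect adj x y.
  apply: NNPP => H; apply: nC => x y; apply/negPn/negP => nxy.
  by apply: H; exists x, y.
pose C z := [set w | connect (@adj G) z w].
have dC z : degree z < #|C z|.
  have -> : degree z = #|[set w | adj z w]| by [].
  rewrite (cardsD1 z (C z)) inE connect0 add1n ltnS; apply: subset_leq_card.
  apply/subsetP => w; rewrite !inE => zw; rewrite connect1 // andbT.
  by apply: contraTneq zw => ->; rewrite adj_irrefl.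
have [z zs] : exists z, #|C z|.*2 <= #|G|.
  have : #|C x| + #|C y| <= #|G|.
    rewrite -cardsUI.
    have -> : C x :&: C y = set0.
      apply/setP => w; rewrite !inE; apply/negP => /andP[xw yw].
      by move/negP: nxy; apply; apply: connect_trans xw _; rewrite csym.
    by rewrite cards0 addn0 max_card.
  by case: (leqP #|C x| #|C y|) => h; [exists x|exists y]; lia.
have Ceq w : w \in C z -> C w = C z.
  rewrite inE => zw; apply/setP => t; rewrite !inE.
  exact/esym/(same_connect csym).
have Cpos : 0 < #|C z| by apply/card_gt0P; exists z; rewrite inE connect0.
case: (leqP #|C z| 1) => C1; first by left; exists z; have := dC z; rewrite -[rdegree _ _]/(degree z); lia.
right; exists #|C z|; rewrite !addn0; split=> //.
  apply: subset_leq_card; apply/subsetP => w /[dup] wC /Ceq E.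
  by rewrite inE -E; apply: dC.
suff -> : [set x0 | rdegree (@adj G) x0 < #|G| - #|C z|] = setT.
  by rewrite cardsT -add1n leq_add2r.
apply/setP => w; rewrite !inE.
case: (boolP (w \in C z)) => wC.
  apply: leq_trans (dC w) _; rewrite Ceq //; lia.
have : C w \subset ~: C z.
  apply/subsetP => t; rewrite !inE => wt; apply: contra wC => zt; rewrite inE.
  by apply: connect_trans zt _; rewrite csym.
move/subset_leq_card; have := cardsC (C z); have := dC w.
rewrite -[rdegree _ _]/(degree w); lia.
Qed.

(** * The extremal structure *)

(* The part sizes of T_r(N), N < 2r, after adding i vertices to a singleton class. *)
Definition extremal_parts r i N :=
  i.+1 :: nseq (N - r) 2 ++ nseq ((minn r N).*2 - N - 1) 1.

Lemma subset_of_card (T : finType) (A : {set T}) i :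
  i <= #|A| -> exists2 B : {set T}, B \subset A & #|B| = i.
Proof.
move=> iA; exists [set x in take i (enum A)].
  by apply/subsetP => x; rewrite inE => /mem_take; rewrite mem_enum.
have un : uniq (take i (enum A)) by rewrite take_uniq // enum_uniq.
rewrite -[RHS](size_takel (s := enum A)) -?cardE // -(card_uniqP un).
by apply: eq_card => x; rewrite inE.
Qed.

Lemma card_Kmulti_class (a : seq nat) (l : 'I_(size a)) :
  #|[set x : {i : 'I_(size a) & 'I_(nth 0 a i)} | tag x == l]| = nth 0 a l.
Proof.
pose T (j : 'I_(size a)) := 'I_(nth 0 a j).
pose h (y : 'I_(nth 0 a l)) : {j : 'I_(size a) & 'I_(nth 0 a j)} := existT T l y.
have inj : injective h by move=> y z /eqP; rewrite eq_Tagged => /eqP.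
rewrite -[RHS]card_ord -cardsT -(card_imset _ inj).
apply: eq_card => -[j y]; rewrite !inE /=; apply/eqP/imsetP => [E|[z _ /(congr1 tag)]] //.
by subst j; exists y; rewrite ?inE.
Qed.

Lemma card_nth_eq (a : seq nat) s :
  #|[set l : 'I_(size a) | nth 0 a l == s]| = count_mem s a.
Proof.
rewrite -sum1dep_card big_mkcond /=.
elim: a => [|b a IH]; first by rewrite big_ord0.
rewrite big_ord_recl /= IH; case: eqP => //.
Qed.

Lemma iso_Kmulti (G : sgraph) r (c : G -> 'I_r) (a : seq nat) :
  (forall x y, adj x y = (c x != c y)) ->
  (forall s, 0 < s -> \sum_k (#|[set x | c x == k]| == s) = count_mem s a) ->
  iso G (Kmulti a).
Proof.
move=> cE ca; apply: iso_trans (iso_colored cE) _; apply: iso_multipartite => s s0.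
transitivity (count_mem s a).
  rewrite -ca // -sum1dep_card big_mkcond /=; apply: eq_bigr => k _.
  by case: eqP.
rewrite -card_nth_eq; apply: eq_card => l; rewrite !inE card_Kmulti_class.
by [].
Qed.

Section Structure.
Variables (G : sgraph) (r i m : nat) (I : {set G}).
Hypotheses (r0 : 0 < r) (i2 : 1 < i) (cf : clique_free r.+1 G).
Hypotheses (cI : #|I| = i) (nE : #|G| = i.*2 + m).
Hypothesis degI : forall x, x \in I -> degree x < i + m.
Hypothesis edges_ge : turan_number r (i + m) + i * (i + m - 1) <= nedges G.
Hypothesis low2 : #|G| < i + m + #|[set x : G | degree x < i + m]|.

Let N := i + m.

Let cJ : #|~: I| = N.
Proof. by have := cardsC I; rewrite /N; lia. Qed.

(** Each [x] in [I] is adjacent to all but one of the N outside vertices. If the missed vertex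
    shared its class, [x] would see every class and complete a K_{r+1}; so it is a singleton class,
    and all classes have size at most 2. [low2] gives [w] outside [I] of degree below N. In a class
    of size 2 it would be adjacent to all of [I] and have degree at least i + N - 2 >= N; so [w] is
    a singleton class, its outside degree is N - 1, and nothing in [I] is adjacent to it. *)
Lemma extremal_structure : N < r.*2 /\ iso G (Kmulti (extremal_parts r i N)).
Proof.
have eg : turan_number r N + i * (N - 1) <= nedges G := edges_ge.
have cfJ : clique_free_in r.+1 (~: I) by move=> A _ /cf.
have TB := turan_bound r0 cfJ; rewrite cJ in TB.
have SP := nedges_split I.
have SI : \sum_(x in I) degree x <= i * (N - 1).
  by rewrite -cI -sum_nat_const; apply: leq_sum => x /degI; rewrite -/N; lia.
(* The assumed edge count reaches the upper bound given by [SP], [TB] and [SI], so all slacks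
   vanish. *)
have dI0 : degree_sum I = 0 by lia.
have dJ : degree_sum (~: I) = (turan_number r N).*2 by lia.
have SIe : \sum_(x in I) degree x = i * (N - 1) by lia.
have degIe x : x \in I -> degree x = N - 1.
  move=> xI; move: SIe; rewrite -cI -sum_nat_const => /eqP.
  have le y : y \in I -> degree y <= N - 1 by move=> /degI; rewrite -/N; lia.
  by case: (leqif_sum (fun y yI => leqif_eq (le y yI))) => _ -> /forall_inP/(_ x xI)/eqP.
have nI x y : x \in I -> y \in I -> ~~ adj x y.
  move=> xI yI; move/eqP: dI0; rewrite /degree_sum sum_nat_eq0 => /forall_inP/(_ x xI).
  rewrite /degree_in cards_eq0 => /eqP/setP/(_ y).
  by rewrite !inE yI /= => ->.
have [c [cr cE csz]] : exists c : G -> nat,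
    [/\ forall x, x \in ~: I -> c x < r,
        {in ~: I &, forall x y, adj x y = (c x != c y)}
      & forall k, k < r -> N %/ r <= #|[set y in ~: I | c y == k]| <= (N %/ r).+1].
  by rewrite -cJ; apply: turan_bound_eq => //; rewrite dJ cJ.
set q := N %/ r in csz.
have degJ x : degree x = degree_in I x + degree_in (~: I) x by apply: degree_inC.
have nn_exists x : x \in I -> exists y, [/\ y \in ~: I, ~~ adj x y &
    forall z, z \in ~: I -> ~~ adj x z -> z = y].
  move=> xI; have E : degree_in I x = 0.
    by apply: eq_card0 => y; rewrite !inE; apply/negP => /andP[yI]; apply/negP/nI.
  have : #|[set y in ~: I | ~~ adj x y]| == 1.
    have := cardsID [set y | adj x y] (~: I); rewrite cJ.
    have -> : #|~: I :&: [set y | adj x y]| = degree_in (~: I) x.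
      by apply: eq_card => y; rewrite !inE.
    have -> : ~: I :\: [set y | adj x y] = [set y in ~: I | ~~ adj x y].
      by apply/setP => y; rewrite !inE andbC.
    by have := degIe x xI; rewrite degJ E /N; lia.
  case/cards1P => y Ey; exists y; have : y \in [set y in ~: I | ~~ adj x y].
    by rewrite Ey inE.
  rewrite inE => /andP[yJ nxy]; split=> // z zJ nxz; apply/set1P; rewrite -Ey.
  by rewrite inE zJ.
have cls x : x \in ~: I -> degree_in (~: I) x + #|[set y in ~: I | c y == c x]| = N.
  move=> xJ; rewrite -cJ -(cardsID [set y | adj x y] (~: I)); congr (_ + _).
    by apply: eq_card => y; rewrite !inE.
  apply: eq_card => y; rewrite !inE; case: (boolP (y \in I)) => yI; rewrite ?andbF //=.
  by rewrite (cE x y xJ) ?in_setC // andbT negbK eq_sym.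
have clspos x : x \in ~: I -> 0 < #|[set y in ~: I | c y == c x]|.
  by move=> xJ; apply/card_gt0P; exists x; rewrite !inE in xJ *; rewrite xJ /=.
have nn_single x y : x \in I -> y \in ~: I -> ~~ adj x y ->
    #|[set z in ~: I | c z == c y]| = 1.
  move=> xI yJ nxy; apply/eqP; rewrite eqn_leq clspos // andbT leqNgt; apply/negP => big.
  have [y' y'c y'y] : exists2 y', y' \in [set z in ~: I | c z == c y] & y' != y.
    have : 0 < #|[set z in ~: I | c z == c y] :\ y|.
      by move: big; rewrite (cardsD1 y) inE yJ eqxx /=; lia.
    by case/card_gt0P => y'; rewrite in_setD1 => /andP[? ?]; exists y'.
  have q1 : 0 < q by have := csz _ (cr _ yJ); lia.
  have [f fP] : exists f : nat -> G, forall k, k < r -> [/\ f k \in ~: I, c (f k) = k & f k != y].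
    (* The default [y] is never returned: every class is nonempty as q >= 1, and the class of [y]
       also contains [y']. *)
    pose f k := odflt y [pick z in ~: I | (c z == k) && (z != y)].
    exists f => k kr; rewrite /f; case: pickP => [z /and3P[? /eqP ? ?] //|none].
    case: (eqVneq k (c y)) => [ky|nky].
      by move: y'c (none y'); rewrite inE -ky => /andP[/= -> ->]; rewrite y'y.
    have /card_gt0P[z] : 0 < #|[set y in ~: I | c y == k]| by have := csz _ kr; lia.
    rewrite inE => /andP[zJ /eqP cz]; move: (none z); rewrite zJ cz eqxx /=.
    by case: eqP => // zy; rewrite -cz zy eqxx in nky.
  pose F (k : 'I_r) := f k.
  have Finj : injective F.
    move=> k l; rewrite /F => E; apply: val_inj => /=.
    have [_ <- _] := fP _ (ltn_ord k); have [_ <- _] := fP _ (ltn_ord l).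
    by rewrite E.
  have xadj k : adj x (F k).
    have [fJ _ fy] := fP _ (ltn_ord k); apply: contraNT fy => nxf.
    have [w [_ _ wu]] := nn_exists x xI.
    by rewrite (wu _ fJ nxf) (wu _ yJ nxy).
  apply: (cf (A := x |: [set F k | k : 'I_r])).
    rewrite cardsU1 card_imset // card_ord.
    suff -> : x \notin [set F k | k : 'I_r] by [].
    apply/imsetP => -[k _ E]; have := xadj k; by rewrite -E adj_irrefl.
  move=> a b; rewrite !inE => /orP[/eqP->|/imsetP[k _ ->]] /orP[/eqP->|/imsetP[l _ ->]].
  - by rewrite eqxx.
  - by rewrite xadj.
  - by rewrite adj_sym xadj.
  have [kJ ck _] := fP _ (ltn_ord k); have [lJ cl _] := fP _ (ltn_ord l).
  rewrite cE // ck cl; apply: contraNneq => E; apply/eqP; congr F; exact: val_inj.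
have [x0 x0I] : exists x, x \in I by apply/card_gt0P; rewrite cI; lia.
have q1 : q <= 1.
  have [y [yJ nxy _]] := nn_exists x0 x0I.
  by rewrite -(nn_single x0 y) //; have /andP[] := csz _ (cr _ yJ).
have [w wJ dw] : exists2 w, w \in ~: I & degree w < N.
  have : 0 < #|[set x : G | degree x < N] :\: I|.
    have := cardsID I [set x : G | degree x < N].
    have := subset_leq_card (subsetIr [set x : G | degree x < N] I).
    rewrite cI; move: low2; rewrite -/N nE /N; lia.
  by case/card_gt0P => w; rewrite !inE => /andP[? ?]; exists w; rewrite ?inE.
have w1 : #|[set y in ~: I | c y == c w]| = 1.
  apply/eqP; rewrite eqn_leq clspos // andbT leqNgt; apply/negP => big.
  have Ei : degree_in I w = i.
    rewrite -cI; apply: eq_card => x; rewrite inE; case: (boolP (x \in I)) => //= xI.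
    apply: contraTT big => nwx; rewrite (nn_single x) // adj_sym.
    exact: nwx.
  have /andP[_] := csz _ (cr _ wJ); have := cls w wJ; rewrite degJ Ei in dw; lia.
have Iw x : x \in I -> ~~ adj x w.
  have : degree_in I w = 0 by have := cls w wJ; rewrite w1; rewrite degJ in dw; lia.
  move=> /eqP; rewrite cards_eq0 => /eqP/setP E xI.
  by have := E x; rewrite !inE xI /= adj_sym => ->.
have Iwy x y : x \in I -> y \in ~: I -> adj x y = (y != w).
  move=> xI yJ; have [z [zJ nxz zu]] := nn_exists x xI.
  rewrite (zu w) ?Iw //; apply/idP/idP; first by apply: contraTneq => ->.
  by apply: contraNT => nxy; rewrite (zu y).
have cw y : y \in ~: I -> (c y == c w) = (y == w).
  move=> yJ; apply/eqP/eqP => [E|-> //]; move/eqP: w1 => /cards1P[z Ez].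
  have : y \in [set z] by rewrite -Ez inE yJ E /=.
  have : w \in [set z] by rewrite -Ez inE wJ /=.
  by rewrite !inE => /eqP-> /eqP->.
have N2 : N < r.*2 by have := divn_eq N r; have := ltn_pmod N r0; rewrite -/q; nia.
split=> //.
pose d x := if x \in I then c w else c x.
have dr x : d x < r by rewrite /d; case: ifP => xI; rewrite cr // inE ?xI.
pose d' x : 'I_r := Ordinal (dr x).
have dE x y : adj x y = (d' x != d' y).
  rewrite -val_eqE /= /d; case: (boolP (x \in I)) => xI; case: (boolP (y \in I)) => yI.
  - by rewrite eqxx (negPf (nI _ _ xI yI)).
  - by rewrite Iwy ?in_setC // [c w == _]eq_sym cw ?in_setC.
  - by rewrite adj_sym Iwy ?in_setC // cw ?in_setC.
  - by rewrite cE ?in_setC.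
pose s k := #|[set y in ~: I | c y == k]|.
have dsz (k : 'I_r) : #|[set x | d' x == k]| = (k == d' w) * i + s k.
  rewrite -cI -(cardsID I); congr (_ + _).
    case: eqP => [->|nk].
      rewrite mul1n; apply: eq_card => x; rewrite !inE -val_eqE /= /d.
      by case: (boolP (x \in I)) => xI; rewrite ?andbF //= andbT; case: ifP => // _; rewrite eqxx.
    rewrite mul0n; apply: eq_card0 => x; rewrite !inE -val_eqE /= /d.
    case: (boolP (x \in I)) => xI; rewrite ?andbF //= andbT.
    apply/eqP => E; apply: nk; apply: val_inj; rewrite /= /d -E.
    by case: ifP.
  apply: eq_card => x; rewrite !inE -val_eqE /= /d.
  by case: (boolP (x \in I)) => xI; rewrite ?andbF //= ?andbT.
have sw : s (d' w) = 1 by rewrite /= /d; case: ifP wJ; rewrite inE => ->.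
have Ssum : \sum_(k < r) s k = N by rewrite (sum_class_size cr) cJ.
apply: (iso_Kmulti dE) => t t0.
rewrite (bigD1 (d' w)) //= dsz eqxx mul1n sw.
have -> : \sum_(k < r | k != d' w) (#|[set x | d' x == k]| == t) =
          \sum_(k < r) (s k == t) - (1 == t).
  rewrite [in RHS](bigD1 (d' w)) //= -/(s (d' w)) sw addKn.
  by apply: eq_bigr => k kw; rewrite dsz (negPf kw).
(* Outside [I] the class sizes are 0 or 1 if N < r, and 1 or 2 if r <= N; their number r and sum N
   then fix the counts. *)
have -> : \sum_(k < r) (s k == t) =
    (t == 1) * ((minn r N).*2 - N) + (t == 2) * (N - r).
  case: (ltnP N r) => Nr.
    have q0 : q = 0 by rewrite /q divn_small.
    rewrite (eq_bigr (fun k : 'I_r => (t == 1) * s k)); last first.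
      by move=> k _; have := csz k (ltn_ord k); rewrite -/(s k) q0; case: (s k) => [|[|]] //; lia.
    rewrite -big_distrr Ssum.
    have -> : N - r = 0 by lia.
    by rewrite muln0 addn0 -addnn addnK.
  have q1' : q = 1 by apply/eqP; rewrite eqn_leq q1 divn_gt0 // Nr.
  have sk (k : 'I_r) : 1 <= s k <= 2 by have := csz k (ltn_ord k); rewrite q1'.
  have S1 : \sum_(k < r) (s k - 1) = N - r.
    rewrite -Ssum -[X in _ - X]muln1 -[r in _ - r * 1]card_ord -sum_nat_const.
    by rewrite sumnB // => k _; have := sk k; lia.
  have S2 : \sum_(k < r) (2 - s k) = r.*2 - N.
    rewrite -Ssum -muln2 -[r in r * 2]card_ord -sum_nat_const.
    by rewrite sumnB // => k _; have := sk k; lia.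
  rewrite -S1 -S2 !big_distrr -big_split /=.
  by apply: eq_bigr => k _; have := sk k; case: (s k) => [|[|[|]]] //; lia.
rewrite addn1 count_cat !count_nseq /=.
have : 0 < (minn r N).*2 - N by rewrite /minn; case: ifP; rewrite /N; lia.
by rewrite !(eq_sym _ t); case: (t =P 1) => [->|_]; rewrite ?mul1n ?mul0n /=; lia.
Qed.

End Structure.

(** * Numerical estimates *)

Lemma turan_number_add r b k :
  turan_number r (b + k) + \sum_(j < k) (b + j) %/ r =
  turan_number r b + \sum_(j < k) (b + j).
Proof.
elim: k => [|k IH]; first by rewrite addn0 !big_ord0.
rewrite addnS turan_numberS !big_ord_recr /=; have := leq_div (b + k) r.
move: IH; set A := \sum_(_ < _) _ %/ _; set B := \sum_(_ < _) _; lia.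
Qed.

Lemma sum_shift_double b k : (\sum_(j < k) (b + j)).*2 + k = k * (b.*2 + k).
Proof.
elim: k => [|k IH]; first by rewrite big_ord0 mul0n.
by rewrite big_ord_recr /=; move: IH; set A := \sum_(_ < _) _; lia.
Qed.

(** Pair j with u - j: two floors add up to at most the floor of the sum, whose numerator 2b + u
    does not depend on j. *)
Lemma sum_divn_le r b u : 0 < r ->
  (\sum_(j < u.+1) (b + j) %/ r).*2 <= u.+1 * ((b.*2 + u) %/ r).
Proof.
move=> r0; rewrite -addnn {2}(reindex_inj rev_ord_inj) -big_split /=.
rewrite -[in X in _ <= X](card_ord u.+1) -sum_nat_const leq_sum // => j _.
rewrite leq_divRL // mulnDl.
apply: leq_trans (leq_add (leq_trunc_div _ _) (leq_trunc_div _ _)) _.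
by have := ltn_ord j; lia.
Qed.

(* The hypotheses on n of all the parts, weakened to a common form; m is l + 1. *)
Definition admissible r m n :=
  [/\ r = 3 -> 6 * m + 20 <= n,
      r = 4 -> m = 0 \/ 5 * m + 6 <= n,
      4 < r < 8 -> [\/ m <= 1, m = 2 /\ 5 < r | 3 * m + 4 <= n]
    & 7 < r -> m <= 2 \/ 4 * (m + 3) <= (r - 4) * (n - m - 4)].

Lemma admissible_mono r m m' n : m' <= m -> admissible r m n -> admissible r m' n.
Proof.
move=> mm [h3 h4 h5 h8]; split=> hr.
- by have := h3 hr; lia.
- by case: (h4 hr); [left|right]; lia.
- case: (h5 hr) => [?|[? ?]|?]; first (by apply: Or31; lia); last by apply: Or33; lia.
  by case: (eqVneq m' 2) => ?; [apply: Or32|apply: Or31]; lia.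
- case: (h8 hr) => h; [left; lia|right]; apply: leq_trans (leq_trans h _); first lia.
  by rewrite leq_mul2l; apply/orP; right; lia.
Qed.

(* Comparison of f(i) = t_r(n - i) + i(i + m - 1) at i = u + 2 with f(1), where
   n = 2i + m + p. *)
Lemma turan_number_compare r m u p :
  let n := u.+2.*2 + m + p in let b := u.+2 + m + p in
  (turan_number r b + u.+2 * (u.+2 + m - 1)).*2 + u.+1 * (p.*2 + u) =
  (turan_number r (n - 1) + m).*2 + (\sum_(j < u.+1) (b + j) %/ r).*2.
Proof.
move=> n b; have := turan_number_add r b u.+1; have := sum_shift_double b u.+1.
have -> : n - 1 = b + u.+1 by rewrite /n /b; lia.
set A := \sum_(_ < _) (_ + _); set B := \sum_(_ < _) _ %/ _; rewrite /b; lia.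
Qed.

(** By [turan_number_compare] the inequality reads 2S <= (u + 1)(2p + u), with S the sum of floors.
    By [sum_divn_le] it is enough that [(b.*2 + u) %/ r] is at most 2p + u. *)
Lemma edge_count_ge4 r m u p : 3 < r ->
  let n := u.+2.*2 + m + p in let b := u.+2 + m + p in
  admissible r m n ->
  turan_number r b + u.+2 * (u.+2 + m - 1) <= turan_number r (n - 1) + m /\
  (turan_number r b + u.+2 * (u.+2 + m - 1) = turan_number r (n - 1) + m ->
   p = 0 /\ [\/ u = 0 | r < 8]).
Proof.
move=> r3 n b [_ a4 a5 a8]; have E := turan_number_compare r m u p.
have r0 : 0 < r by lia.
have D := sum_divn_le b u r0.
rewrite -/n -/b /= in E.
set S := \sum_(j < _) _ in D E.
suff [Sle Slt] : S.*2 <= u.+1 * (p.*2 + u) /\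
    (S.*2 = u.+1 * (p.*2 + u) -> p = 0 /\ [\/ u = 0 | r < 8]).
  by split=> [|E']; [lia|apply: Slt; lia].
case: (leqP r (b + u)) => big; last first.
  have -> : S = 0 by apply: big1 => j _; rewrite divn_small //; have := ltn_ord j; lia.
  split=> // /esym/eqP; rewrite muln_eq0 /= => /eqP z.
  by split; [lia|left; lia].
(* The first part bounds the averaged floor by 2p + u. The second makes that bound strict unless p =
   0 and r < 8, which confines the equality case. *)
have K1 : b.*2 + u < r * (p.*2 + u).+1 /\ ((p = 0 /\ r < 8) \/ b.*2 + u < r * (p.*2 + u)).
  case: (ltnP r 8) => r8; last first.
    suff : b.*2 + u < r * (p.*2 + u) by move=> h; split; [lia|right].
    have [s rs] : exists s, r = s + 4 by exists (r - 4); lia.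
    rewrite rs in big r8 a8 *; rewrite /b /n in big a8 *.
    case: (a8 _); first by lia.
      move=> m2; apply: (@leq_trans (8 * (p.*2 + u))); last by rewrite leq_mul2r; lia.
      lia.
    rewrite addnK; have -> : u.+2.*2 + m + p - m - 4 = u.*2 + p by lia.
    by lia.
  have rc : r = 4 \/ r = 5 \/ r = 6 \/ r = 7 by lia.
  rewrite /b /n in a4 a5 big *.
  by case: rc => [er|[er|[er|er]]]; rewrite er in a4 a5 big *;
    [case: (a4 erefl)|case: (a5 isT)|case: (a5 isT)|case: (a5 isT)]; lia.
case: K1 => K1 K2; have lt1 : (b.*2 + u) %/ r <= p.*2 + u by rewrite -ltnS ltn_divLR // mulnC.
split; first by apply: leq_trans D _; rewrite leq_mul2l lt1 orbT.
move=> Se; case: K2 => [[-> ?]|K2]; first by split=> //; right.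
have lt2 : (b.*2 + u) %/ r < p.*2 + u by rewrite ltn_divLR // mulnC.
by move: D; rewrite Se leq_mul2l /= leqNgt lt2.
Qed.

(* The entries of Hhat_table with r, m = l + 1 and n admissible. *)
Definition tight_table : seq (nat * seq nat * nat * nat) :=
  [:: (0, [:: 4; 1; 1], 4, 6); (0, [:: 5; 1; 1; 1], 4, 8);
      (1, [:: 6; 2; 2; 1], 4, 11); (1, [:: 4; 1; 1; 1], 5, 7);
      (1, [:: 5; 1; 1; 1; 1], 5, 9); (2, [:: 4; 1; 1; 1; 1], 6, 8);
      (2, [:: 5; 2; 1; 1; 1], 5, 10); (2, [:: 5; 1; 1; 1; 1; 1], 6, 10);
      (3, [:: 6; 2; 2; 2; 1], 5, 13)].

(** Equality at i = 2 gives K_{3,1,...,1} for every large enough r; equality at i >= 3 forces r < 8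
    and ends in the table. *)
Definition sporadic (r m n : nat) (G : sgraph) : Prop :=
  [/\ m <= 2, m.+3 <= r, n = m.+4 & iso G (Kmulti (3 :: nseq m.+1 1))] \/
  exists2 a, (m, a, r, n) \in tight_table & iso G (Kmulti a).

(** The equality case at i = u + 2 and n = 2i + m; the [sumn] condition is f(i) = f(1) in the form
    of [turan_number_compare]. *)
Definition tight_check r u m :=
  let n := u.+2.*2 + m in
  [&& u.+2 + m < r.*2, ((r == 4) ==> (m == 0) || (5 * m + 6 <= n)),
      ((4 < r) ==> [|| m <= 1, (m == 2) && (5 < r) | 3 * m + 4 <= n]) &
      (sumn [seq (u.+2 + m + j) %/ r | j <- iota 0 u.+1]).*2 == u.+1 * u] ==>
  [|| u == 0 | (m, extremal_parts r u.+2 (u.+2 + m), r, n) \in tight_table].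

(** The range up to 14 is ample because u + 2 + m < 2r <= 14. *)
Lemma tight_checked :
  all (fun r => all (fun u => all (tight_check r u) (iota 0 14)) (iota 0 14))
    [:: 4; 5; 6; 7].
Proof. by vm_compute. Qed.

Lemma sporadic_extremal r m u (G : sgraph) : 3 < r ->
  let n := u.+2.*2 + m in let N := u.+2 + m in
  admissible r m n -> N < r.*2 ->
  turan_number r N + u.+2 * (u.+2 + m - 1) = turan_number r (n - 1) + m ->
  iso G (Kmulti (extremal_parts r u.+2 N)) -> sporadic r m n G.
Proof.
move=> r3 n N adm N2 E isoG.
have adm0 : admissible r m (u.+2.*2 + m + 0) by rewrite addn0.
have [_] := edge_count_ge4 r3 adm0.
rewrite !addn0 => /(_ E)[_ u0r8]; have [_ a4 a5 a8] := adm.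
case: (eqVneq u 0) => [u0|un0].
  (* At n = m + 4 admissibility leaves m = 0 for r = 4, m <= 1 for r = 5 and m <= 2 for larger r. *)
  have mr : m.+2 < r.
    have n4 : n = m + 4 by rewrite /n u0; lia.
    rewrite n4 in a4 a5 a8.
    case: (ltngtP r 4) => [|r4|r4]; [lia| |by have := a4 r4; lia].
    case: (ltnP r 8) => r8; first by case: (a5 _); lia.
    by case: (a8 r8); [lia|rewrite addKn subnn muln0; lia].
  left; split=> //; [|by rewrite /n u0; lia|].
    have n4 : n = m + 4 by rewrite /n u0; lia.
    rewrite n4 in a4 a5 a8.
    case: (ltngtP r 4) => [|r4|r4]; [lia| |by have := a4 r4; lia].
    case: (ltnP r 8) => r8; first by case: (a5 _); lia.
    by case: (a8 r8); [lia|rewrite addKn subnn muln0; lia].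
  move: isoG; rewrite /N u0 /extremal_parts.
  have -> : 2 + m - r = 0 by lia.
  have -> : (minn r (2 + m)).*2 - (2 + m) - 1 = m.+1 by rewrite minnE; lia.
  by [].
right; exists (extremal_parts r u.+2 N) => //.
have r8 : r < 8 by case: u0r8 => // u0; rewrite u0 in un0.
have S := turan_number_compare r m u 0; rewrite /= !addn0 -/n -/N E add0n in S.
have : tight_check r u m.
  have rin : r \in [:: 4; 5; 6; 7] by rewrite !inE; lia.
  have uin : u \in iota 0 14 by rewrite mem_iota; rewrite /N in N2; lia.
  have min : m \in iota 0 14 by rewrite mem_iota; rewrite /N in N2; lia.
  by have /allP/(_ r rin)/allP/(_ u uin)/allP/(_ m min) := tight_checked.
rewrite /tight_check -/n -/N (negPf un0) => /implyP; apply.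
apply/and4P; split=> //.
- by apply/implyP => /eqP /a4[]->; rewrite ?orbT.
- by apply/implyP => r4; apply/or3P; case: (a5 _) => [|?|[-> ->]|?];
    [lia|apply: Or31|apply: Or32|apply: Or33].
- rewrite sumnE big_map -[iota 0 u.+1]/(index_iota 0 u.+1) big_mkord.
  apply/eqP; move: S; rewrite -/N; set B := \sum_(_ < _) _; lia.
Qed.

Lemma sum_class_size_mix (T : finType) r (X : {set T}) (c : T -> nat) :
  (forall x, c x < r) ->
  \sum_(x in X) #|[set y | c y == c x]| =
  \sum_(k < r) #|[set y | c y == k]| * #|[set y in X | c y == k]|.
Proof.
move=> cr; transitivity (\sum_(k < r) \sum_(x in X | c x == k) #|[set y | c y == c x]|).
  rewrite (eq_bigr (fun k : 'I_r => \sum_(x in X) if c x == k then #|[set y | c y == c x]| else 0));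
    last by move=> k _; rewrite big_mkcondr.
  rewrite exchange_big /=; apply: eq_bigr => x xX.
  by rewrite -big_mkcond /= (big_pred1 (Ordinal (cr x))).
apply: eq_bigr => k _.
rewrite (eq_bigr (fun _ => #|[set y | c y == k]|)); last by move=> x /andP[_ /eqP->].
rewrite sum_nat_const mulnC; congr (_ * _).
by apply: eq_card => x; rewrite !inE.
Qed.

(** With y_k = 2s_k - x_k, each s_k(s_k - x_k) is (y_k^2 - x_k^2) / 4. Cauchy gives that 3 times the
    sum of y_k^2 is at least (2n - x)^2, and the sum of x_k^2 is at most x^2. *)
Lemma mixed_square_sum (s0 s1 s2 x0 x1 x2 : nat) :
  x0 <= s0 -> x1 <= s1 -> x2 <= s2 ->
  let n := s0 + s1 + s2 in let x := x0 + x1 + x2 in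
  2 * n ^ 2 <= 6 * (s0 * (s0 - x0) + s1 * (s1 - x1) + s2 * (s2 - x2)) + 2 * n * x + x ^ 2.
Proof.
move=> /subnKC; set a0 := s0 - x0 => <-; move=> /subnKC; set a1 := s1 - x1 => <-.
move=> /subnKC; set a2 := s2 - x2 => <- /=.
have [C01 _] := nat_Cauchy (x0 + 2 * a0) (x1 + 2 * a1).
have [C02 _] := nat_Cauchy (x0 + 2 * a0) (x2 + 2 * a2).
have [C12 _] := nat_Cauchy (x1 + 2 * a1) (x2 + 2 * a2).
clearbody a0 a1 a2; rewrite -!mulnn in C01 C02 C12 *.
have := leq0n (x0 * x1); have := leq0n (x0 * x2); have := leq0n (x1 * x2).
lia.
Qed.

(* The degrees are majorized by those of a complete tripartite graph, and by D on X;
   the resulting bound is largest when X lies in one part. *)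
Lemma edge_bound_K4_free (G : sgraph) (X : {set G}) D :
  clique_free 4 G -> (forall x, x \in X -> degree x <= D) ->
  12 * nedges G + 4 * #|G| * #|X| <= 6 * #|X| * D + 4 * #|G| ^ 2 + #|X| ^ 2.
Proof.
move=> cf degX.
have cfT : clique_free_in 4 [set: G] by move=> A _ /cf.
have [c [cr cm _]] := erdos_majorization cfT.
have {}cr x : c x < 3 by apply: cr.
have {}cm x : degree x + #|[set y | c y == c x]| <= #|G|.
  have := cm x (in_setT x); rewrite degree_inT cardsT; congr (_ + _ <= _).
  by apply: eq_card => y; rewrite !inE.
have H := handshake G; rewrite (bigID (mem X)) /= in H.
have HX : \sum_(x in X) degree x <= #|X| * D.
  by rewrite -sum_nat_const; apply: leq_sum.
have HY : \sum_(x | x \notin X) degree x +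
    \sum_(x in ~: X) #|[set y | c y == c x]| <= #|~: X| * #|G|.
  rewrite -sum_nat_const.
  rewrite (eq_bigl (fun x => x \in ~: X)) -?big_split /=; last by move=> x; rewrite inE.
  exact: leq_sum.
rewrite (sum_class_size_mix _ cr) in HY.
have crT x : x \in [set: G] -> c x < 3 by [].
have crX x : x \in X -> c x < 3 by [].
have SG := sum_class_size crT; have SX := sum_class_size crX.
have cY := cardsC X.
pose s k := #|[set y | c y == k]|; pose xx k := #|[set y in X | c y == k]|.
have sT k : #|[set y in [set: G] | c y == k]| = s k by apply: eq_card => y; rewrite !inE.
have sY k : #|[set y in ~: X | c y == k]| = s k - xx k.
  rewrite /s -(cardsID X [set y | c y == k]).
  have -> : [set y | c y == k] :&: X = [set y in X | c y == k].
    by apply/setP => y; rewrite !inE andbC.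
  by rewrite /xx addKn; apply: eq_card => y; rewrite !inE.
have xs k : xx k <= s k.
  by apply: subset_leq_card; apply/subsetP => y; rewrite !inE => /andP[].
move: SG SX HY; rewrite !big_ord_recr !big_ord0 /= !sT !sY -!/(s _) -!/(xx _) !add0n cardsT.
move=> SG SX; have := mixed_square_sum (xs 0) (xs 1) (xs 2); rewrite /= SG SX.
set S := s 0 * _ + _ + _; rewrite -!mulnn.
have -> : #|~: X| = #|G| - #|X| by lia.
have XG : #|X| <= #|G| by lia.
move: (#|G|) (#|X|) S XG H HX => n x S XG H HX.
rewrite mulnBl; have : x * n <= n * n by rewrite leq_mul2r XG orbT.
lia.
Qed.

Lemma turan_number3 n : 4 * n ^ 2 <= 12 * turan_number 3 n + 4.
Proof.
have := @turan_number_double 3 n isT; have := divn_eq n 3; have := ltn_pmod n (isT : 0 < 3).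
move: (n %/ 3) (n %% 3) (turan_number 3 n) => q t T t3 -> ; rewrite -!mulnn.
by case: t t3 => [|[|[|]]] // _; lia.
Qed.

(** For i = 2 deletion and Turán's theorem still suffice; for i >= 3 [edge_bound_K4_free], applied
    to i low vertices, leaves a quadratic inequality. *)
Lemma edge_count_K4_free (G : sgraph) i m : clique_free 4 G -> 1 < i ->
  i.*2 + m <= #|G| -> 6 * m + 20 <= #|G| ->
  i <= #|[set x : G | degree x < i + m]| ->
  #|G| < i + m + #|[set x : G | degree x < #|G| - i]| ->
  nedges G < turan_number 3 (#|G| - 1) + m.
Proof.
move=> cf i2 inm nm low1 low2.
have [I sI cI] := subset_of_card low1.
have degI x : x \in I -> degree x <= i + m - 1.
  by move=> /(subsetP sI); rewrite inE; lia.
have B := edge_bound_K4_free cf degI; rewrite cI in B.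
have T := turan_number3 (#|G| - 1).
have T' : 4 * (#|G| * #|G|) + 4 <= 12 * turan_number 3 (#|G| - 1) + 4 + 8 * #|G|.
  have nE : #|G| = (#|G| - 1).+1 by lia.
  by rewrite -mulnn in T; rewrite {1 2 4}nE; lia.
case: (eqVneq i 2) => [i_2|ni2].
  have SP := nedges_split I.
  have cfI : clique_free_in 4 (~: I) by move=> A _ /cf.
  have TB := turan_bound (isT : 0 < 3) cfI.
  have cC : #|~: I| = #|G| - 2 by have := cardsC I; lia.
  rewrite cC in TB.
  have SD : \sum_(x in I) degree x <= 2 * (m + 1).
    rewrite -[in X in _ <= X]i_2 -cI -sum_nat_const; apply: leq_sum => x /degI; lia.
  have := turan_numberS 3 (#|G| - 2).
  have -> : (#|G| - 2).+1 = #|G| - 1 by lia.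
  lia.
(* The one case where the quadratic inequality below degenerates, to 860 = 860. Here [low2] gives 11
   vertices of degree at most 9, and the bound drops below t_3(19) = 120. *)
case: (boolP [&& #|G| == 20, m == 0 & i == 10]) => [/and3P[/eqP n20 /eqP m0 /eqP i10]|ne].
  have : 11 <= #|[set x : G | degree x < 10]|.
    by move: low2; rewrite n20 m0 i10 -[20 - 10]/10 -[10 + 0]/10 -[20]/(10 + 10) ltn_add2l.
  case/subset_of_card => J sJ cJ.
  have degJ x : x \in J -> degree x <= 9 by move=> /(subsetP sJ); rewrite inE; lia.
  have := edge_bound_K4_free cf degJ; rewrite cJ n20 m0 -[20 - 1]/19.
  have := @turan_number_double 3 19 isT; rewrite -[19 %/ 3]/6; lia.
suff : 7 * (i * i) + 6 * (i * m) + 8 * #|G| < 4 * (#|G| * i) + 12 * m + 6 * i.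
  rewrite -!mulnn in B.
  have : i * (i + m - 1) + i = i * i + i * m.
    by rewrite -mulnDr -mulnSr; congr (_ * _); lia.
  lia.
have [p pE] : exists p, #|G| = i.*2 + m + p by exists (#|G| - (i.*2 + m)); lia.
rewrite pE in nm ne *.
have i3 : 3 <= i by lia.
(* From n >= 6m + 20 comes 2i + p >= 5m + 20. These products make the goal linear unless m = p = 0;
   then n = 2i, and i >= 11 since i = 10 is the case already treated. *)
have H1 : i * (5 * m + 20) <= i * (i.*2 + p) by rewrite leq_mul2l; apply/orP; right; lia.
have H2 : 3 * p <= i * p by rewrite leq_mul2r i3 orbT.
have H3 : 3 * m <= i * m by rewrite leq_mul2r i3 orbT.
case: (posnP (m + p)) => mp; last by lia.
have m0 : m = 0 by lia.
have p0 : p = 0 by lia.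
rewrite m0 p0 in ne nm *.
have i11 : 11 <= i by lia.
have : 11 * i <= i * i by rewrite leq_mul2r i11 orbT.
lia.
Qed.

Lemma degree_sum1 (G : sgraph) (v : G) : degree_sum [set v] = 0.
Proof.
rewrite /degree_sum big_set1; apply: eq_card0 => y; rewrite !inE.
by apply/andP => -[/eqP->]; rewrite adj_irrefl.
Qed.

Lemma nedges_del1 (G : sgraph) (v : G) : nedges G = nedges (del [set v]) + degree v.
Proof.
by have := nedges_split [set v]; rewrite degree_sum1 degree_sum_del big_set1; lia.
Qed.

Lemma clique_free_del (G : sgraph) (S : {set G}) s : clique_free s G -> clique_free s (del S).
Proof.
move=> cf A cA clA; apply: (cf (val @: A)); first by rewrite card_imset //; apply: val_inj.
move=> _ _ /imsetP[x xA ->] /imsetP[y yA ->] nxy; apply: (clA x y xA yA).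
by apply: contraNneq nxy => ->.
Qed.

Lemma turan_nedges_le (G : sgraph) r : 0 < r -> clique_free r.+1 G ->
  nedges G <= turan_number r #|G| /\ (nedges G = turan_number r #|G| -> iso G (turan r #|G|)).
Proof.
move=> r0 cf; have cfT : clique_free_in r.+1 [set: G] by move=> A _ /cf.
split.
  by have := turan_bound r0 cfT; rewrite degree_sumT cardsT leq_double.
move=> E; have := turan_bound_eq r0 cfT; rewrite degree_sumT cardsT E => /(_ erefl).
case=> c [cr cE csz]; apply: (iso_turan r0 (c := c)) => [x|x y|k kr].
- exact: cr.
- exact: cE.
have := csz k kr; congr (_ <= _ <= _); apply: eq_card => y; by rewrite !inE.
Qed.

Lemma small_degree_bound (G : sgraph) r m (v : G) : 0 < r -> clique_free r.+1 G ->
  degree v <= m ->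
  nedges G <= turan_number r (#|G| - 1) + m /\
  (nedges G = turan_number r (#|G| - 1) + m ->
   forall l : int, (l + 1)%R = m%:Z%R -> in_calG #|G| r l G).
Proof.
move=> r0 cf dv; have E := nedges_del1 v.
have [le eq] := turan_nedges_le r0 (clique_free_del (S := [set v]) cf).
rewrite card_del cards1 in le eq; split; first lia.
move=> e l lm; split=> //; exists v; last by apply: eq; lia.
by rewrite lm; congr Posz; lia.
Qed.

Theorem low_edge_bound (G : sgraph) r m : 3 <= r -> clique_free r.+1 G ->
  admissible r m #|G| -> low m G ->
  nedges G <= turan_number r (#|G| - 1) + m /\
  (nedges G = turan_number r (#|G| - 1) + m ->
   (forall l : int, (l + 1)%R = m%:Z%R -> in_calG #|G| r l G) \/ sporadic r m #|G| G).
Proof.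
move=> r3 cf adm; have r0 : 0 < r by lia.
case=> [[v dv]|[i [i2 inm low1 low2]]].
  by have [le eq] := small_degree_bound r0 cf dv; split=> // /eq; left.
case: (ltngtP r 3) => [|r4|r_3]; first by lia.
  have [I sI cI] := subset_of_card low1.
  have degI x : x \in I -> degree x < i + m by move=> /(subsetP sI); rewrite inE.
  have SP := nedges_split I.
  have cfI : clique_free_in r.+1 (~: I) by move=> A _ /cf.
  have TB := turan_bound r0 cfI.
  have cC : #|~: I| = #|G| - i by have := cardsC I; lia.
  have SD : \sum_(x in I) degree x <= i * (i + m - 1).
    by rewrite -cI -sum_nat_const; apply: leq_sum => x /degI; rewrite cI; lia.
  set S := \sum_(x in I) degree x in SP SD.
  have [u iu] : exists u, i = u.+2 by exists (i - 2); lia.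
  have [p pE] : exists p, #|G| = i.*2 + m + p by exists (#|G| - (i.*2 + m)); lia.
  have bE : #|G| - i = i + m + p by lia.
  rewrite cC bE in TB; rewrite pE in adm; rewrite iu in adm.
  have [le eq] : turan_number r (i + m + p) + i * (i + m - 1) <= turan_number r (#|G| - 1) + m /\
      (turan_number r (i + m + p) + i * (i + m - 1) = turan_number r (#|G| - 1) + m -> p = 0).
    by rewrite pE iu; have [le eq] := edge_count_ge4 r4 adm; split=> // /eq[].
  split; first by lia.
  move=> e; right; have p0 : p = 0 by apply: eq; lia.
  rewrite p0 !addn0 in pE bE adm le TB.
  have [N2 isoG] : i + m < r.*2 /\ iso G (Kmulti (extremal_parts r i (i + m))).
    apply: (extremal_structure r0 i2 cf cI pE degI); first by lia.
    by rewrite bE in low2.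
  have E : turan_number r (i + m) + i * (i + m - 1) = turan_number r (#|G| - 1) + m by lia.
  rewrite pE iu in E *; rewrite iu in N2 isoG.
  exact: (sporadic_extremal r4 adm N2 E isoG).
rewrite r_3 in cf adm *.
have [/(_ erefl) a3 _ _ _] := adm.
have := edge_count_K4_free cf i2 inm a3 low1 low2; lia.
Qed.

(** * Graphs in calG and Kmulti *)

Section TuranPlusVertex.
Variables (r N : nat) (M : {set 'I_N}).

(** [None] is the extra vertex and [M] its neighbourhood; if [M] avoids a residue class, [None] can
    take that colour. *)
Definition turan_plus_adj : rel (option 'I_N) := fun x y =>
  match x, y with
  | Some i, Some j => i %% r != j %% r
  | Some i, None | None, Some i => i \in M
  | None, None => false
  end.

Lemma turan_plus_sym : symmetric turan_plus_adj.
Proof. by move=> [i|] [j|] //=; rewrite eq_sym. Qed.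

Lemma turan_plus_irrefl : irreflexive turan_plus_adj.
Proof. by move=> [i|] //=; rewrite eqxx. Qed.

Definition turan_plus := SGraph turan_plus_sym turan_plus_irrefl.

Lemma degree_turan_plus : degree (None : turan_plus) = #|M|.
Proof.
rewrite -(card_imset _ (@Some_inj _)); apply: eq_card => -[i|]; rewrite inE.
  by rewrite (mem_imset _ _ (@Some_inj _)).
by apply/esym/imsetP => -[].
Qed.

Lemma del_turan_plus : iso (del [set (None : turan_plus)]) (turan r N).
Proof.
apply: iso_sym.
have nN (i : 'I_N) : (Some i : turan_plus) \notin [set (None : turan_plus)] by rewrite inE.
exists (fun i => exist _ (Some i : turan_plus) (nN i)) => //.
exists (fun x : del [set (None : turan_plus)] =>
          match val x as o return o \notin [set (None : turan_plus)] -> 'I_N with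
          | Some i => fun _ => i
          | None => fun h => False_rect _ (negP h (set11 _))
          end (valP x)) => //.
move=> [[i|] h]; apply: val_inj => //=.
by case: (negP h (set11 _)).
Qed.

Lemma clique_free_turan_plus : 0 < r -> (forall i, i \in M -> i %% r != N %% r) ->
  clique_free r.+1 turan_plus.
Proof.
move=> r0 MN A cA clA.
pose c (x : turan_plus) : 'I_r :=
  Ordinal (ltn_pmod (if x is Some i then val i else N) r0).
have cinj : {in A &, injective c}.
  move=> x y xA yA cxy; apply/eqP/negPn/negP => nxy.
  have := clA x y xA yA nxy; case/(congr1 val): cxy => /=.
  case: x y {xA yA nxy} => [i|] [j|] //= E; rewrite /adj /= ?E ?eqxx //.
  - by move=> /MN; rewrite E eqxx.
  - by move=> /MN; rewrite E eqxx.
by have := max_card (c @: A); rewrite card_in_imset // card_ord cA ltnn.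
Qed.

End TuranPlusVertex.

Lemma calG_exists r n m (l : int) : 0 < r -> 0 < n -> m <= (n - 1) - (n - 1) %/ r ->
  (l + 1)%R = m%:Z%R -> exists G : sgraph, in_calG n r l G.
Proof.
move=> r0 n0 le lm; set N := n - 1 in le.
(* The class of N modulo r has the minimal size [N %/ r], so avoiding it leaves the most room for
   neighbours. *)
pose A := [set i : 'I_N | i %% r != N %% r].
have cA : #|A| = N - N %/ r.
  have := cardsC [set i : 'I_N | i %% r == N %% r].
  rewrite card_residue ?ltn_pmod // ltnn addn0 card_ord.
  have -> : ~: [set i : 'I_N | i %% r == N %% r] = A by apply/setP => i; rewrite !inE.
  lia.
rewrite -cA in le; have [M sM cM] := subset_of_card le.
exists (turan_plus r M); split.
- by rewrite card_option card_ord /N; lia.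
- by apply: clique_free_turan_plus => // i /(subsetP sM); rewrite inE.
- exists None; first by rewrite degree_turan_plus cM.
  exact: del_turan_plus.
Qed.

Lemma calG_nedges n r m (l : int) (G : sgraph) : 0 < r -> (l + 1)%R = m%:Z%R ->
  in_calG n r l G -> nedges G = turan_number r (n - 1) + m.
Proof.
move=> r0 lm [_ _ [v dv /iso_nedges E]].
by rewrite (nedges_del1 v) E nedges_turan //; congr (_ + _); move: dv; rewrite lm => -[].
Qed.

Lemma admissible_calG r m n : 2 < r -> admissible r m n -> m < n ->
  m <= (n - 1) - (n - 1) %/ r.
Proof.
move=> r3 [a3 a4 a5 a8] mn.
have D3 : (n - 1) %/ r <= (n - 1) %/ 3 by apply: leq_div2l.
case: (ltnP (n - 1) r) => nr; first by rewrite divn_small //; lia.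
case: (eqVneq r 3) => [/a3|n3]; first by lia.
case: (eqVneq r 4) => [/a4|n4]; first by lia.
case: (ltnP r 8) => r8; first by case: (a5 _); lia.
case: (a8 r8) => h; first by lia.
case: (leqP m (n - 1 - (n - 1) %/ r)) => // big.
have L := leq_trunc_div (n - 1) r; move: big L; set q := _ %/ r => big L.
have : (r - 4) * (n - m - 4) <= (r - 4) * q by rewrite leq_mul2l; apply/orP; right; lia.
rewrite [(r - 4) * q]mulnBl; lia.
Qed.

(** * Obstructions caused by a vertex of small degree *)

Lemma hamiltonian_degree (G : sgraph) (v : G) : hamiltonian G -> 1 < degree v.
Proof.
case=> c [sz /andP[cyc un] span].
have [i s rs] := rot_to (span v).
move: sz cyc un; rewrite -(size_rot i) -(rot_cycle i) -(rot_uniq i) rs.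
case: s {rs} => [|a s] //; case/lastP: s => [|s b] // _.
rewrite /= rcons_path last_rcons => /andP[va /andP[_ bv]] /and3P[_ ab _].
have : #|[set a; b]| <= degree v.
  apply: subset_leq_card; apply/subsetP => x; rewrite !inE.
  by case/orP => /eqP->; rewrite ?va // adj_sym.
rewrite cards2; suff -> : a != b by [].
by apply: contraNneq ab => ->; rewrite mem_rcons inE eqxx.
Qed.

Lemma isolated_connect (G : sgraph) (v y : G) : degree v = 0 -> connect adj v y -> y = v.
Proof.
move=> /eqP; rewrite cards_eq0 => /eqP/setP dv /connectP[[|z p] //= /andP[vz _] _].
by have := dv z; rewrite !inE vz.
Qed.

Lemma traceable_connected (G : sgraph) : traceable G -> connected G.
Proof.
case=> x [p [pp _ span]] y z.
have sym := sym_connect_sym (@adj_sym G).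
apply: (@connect_trans _ _ x); last exact: (path_connect pp).
by rewrite sym; apply: (path_connect pp).
Qed.

Lemma isolated_not_connected (G : sgraph) (v : G) : degree v = 0 -> 1 < #|G| -> ~ connected G.
Proof.
move=> dv; rewrite -cardsT (cardsD1 v) inE ltnS => /card_gt0P[y].
by rewrite !inE andbT => /eqP yv C; apply: yv; apply: isolated_connect (C v y).
Qed.

(** On a Hamiltonian path joining the two neighbours of [v], these ends must be the path neighbours
    of [v], so the path has only three vertices. *)
Lemma ham_connected_degree (G : sgraph) (v : G) : 3 < #|G| -> ham_connected G -> degree v != 2.
Proof.
move=> G3 HC; apply/negP => /cards2P[x [y [xy Nv]]].
have nv z : adj v z = (z == x) || (z == y) by have /setP/(_ z) := Nv; rewrite !inE.
have ax : adj v x by rewrite nv eqxx.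
have ay : adj v y by rewrite nv eqxx orbT.
have vx : v != x by apply: contraTneq ax => ->; rewrite adj_irrefl.
have vy : v != y by apply: contraTneq ay => ->; rewrite adj_irrefl.
have [p [pp un span] lp] := HC x y xy.
have vp : v \in p by have := span v; rewrite inE (negPf vx).
have szp : #|G| = (size p).+1.
  by rewrite -[RHS](card_uniqP un); apply: eq_card => z; rewrite span.
move: G3 pp un lp; rewrite szp; case/splitPr: vp => p1 p2 {span szp}.
rewrite cat_path last_cat /= => sz /and3P[_ lv p2p] un lp.
have p1nil : p1 = [::].
  case: p1 / lastP sz lv un => // p1 a _; rewrite last_rcons adj_sym nv => /orP[]/eqP->.
    by rewrite mem_cat mem_rcons inE eqxx.
  rewrite cat_uniq => /and4P[_ _ /hasPn/(_ y) + _].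
  by rewrite -{1}lp mem_last mem_rcons inE eqxx => /(_ isT).
move: sz un p2p lp; rewrite p1nil /=; case: p2 {lv} => [|z [|t p2]] //=.
rewrite nv => _ un /andP[zxy _] lp; move: zxy un => /orP[]/eqP->.
  by rewrite !inE eqxx !orbT.
by rewrite -{3}lp mem_last /= !andbF.
Qed.

(** Brings a vertex down to degree 1, 2 or 0, which obstructs a Hamiltonian cycle,
    Hamiltonian-connectedness or connectedness respectively. *)
Lemma degree_del_nbrs (G : sgraph) (v : G) j : j <= degree v ->
  exists (S : {set G}) (w : del S), #|S| = j /\ degree w = degree v - j.
Proof.
case/subset_of_card => S sS cS.
have vS : v \notin S by apply/negP => /(subsetP sS); rewrite inE adj_irrefl.
exists S, (exist _ v vS); split=> //; rewrite degree_del /=.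
rewrite (degree_inC S) -cS; suff -> : degree_in S v = #|S| by rewrite addKn.
by apply: eq_card => x; rewrite inE; case: (boolP (x \in S)) => //= /(subsetP sS); rewrite inE.
Qed.

Lemma low_degree_not_k_hamiltonian (G : sgraph) (v : G) k :
  degree v = k.+1 -> ~ k_hamiltonian k G.
Proof.
move=> dv H; have [|S [w [cS dw]]] := @degree_del_nbrs G v k; first by lia.
by have := hamiltonian_degree w (H S (eq_leq cS)); rewrite dw dv subSnn.
Qed.

Lemma low_degree_not_k_ham_connected (G : sgraph) (v : G) k : 0 < k -> k + 3 <= #|G| ->
  degree v = k.+1 -> ~ k_ham_connected k G.
Proof.
move=> k0 kn dv H; have [|S [w [cS dw]]] := @degree_del_nbrs G v k.-1; first by lia.
have Sk : #|S| < k by lia.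
have := ham_connected_degree w _ (H S Sk); rewrite card_del dw; lia.
Qed.

Lemma low_degree_not_k_connected (G : sgraph) (v : G) k : 0 < k -> k < #|G| ->
  degree v = k.-1 -> ~ k_connected k G.
Proof.
move=> k0 kn dv H; have [|S [w [cS dw]]] := @degree_del_nbrs G v k.-1; first by lia.
have Sk : #|S| < k by lia.
by apply: (isolated_not_connected (v := w)) (H S Sk); rewrite ?card_del ?dw; lia.
Qed.

(** * Order, edges and connectivity of the sporadic graphs *)

Lemma card_Kmulti (a : seq nat) : #|Kmulti a| = sumn a.
Proof.
rewrite card_tagged !sumnE big_map big_enum /=.
under eq_bigr do rewrite card_ord.
by rewrite -(big_mkord xpredT (fun i => nth 0 a i)) -(big_nth 0 xpredT id).
Qed.

Lemma nedges_Kmulti (a : seq nat) :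
  (nedges (Kmulti a)).*2 + sumn [seq x ^ 2 | x <- a] = (sumn a) ^ 2.
Proof.
have := nedges_multipartite (fun x : {i : 'I_(size a) & 'I_(nth 0 a i)} => tag x).
rewrite -/(Kmulti a).
rewrite [#|_|]card_Kmulti => <-; congr (_ + _).
under [RHS]eq_bigr do rewrite card_Kmulti_class.
rewrite (partition_big (fun x => tag x) xpredT) //=.
rewrite sumnE big_map (big_nth 0) big_mkord; apply: eq_bigr => l _.
rewrite (eq_bigr (fun _ => nth 0 a l)); last by move=> x /eqP->.
by rewrite sum_nat_const -(card_Kmulti_class l) -mulnn; congr (_ * _); apply: eq_card => x; rewrite inE.
Qed.

(** Non-adjacent vertices share a part and hence their at least [k] neighbours, one of which
    survives the deletion. This excludes sporadic graphs from the connectivity part. *)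
Lemma Kmulti_k_connected (G : sgraph) (a : seq nat) k :
  iso G (Kmulti a) -> all (fun x => k + x <= sumn a) a -> k_connected k G.
Proof.
case=> f bf fE /allP ak S Sk x y.
have trans z : ~~ adj (val x) (val y) -> adj (val x) z -> adj z (val y).
  rewrite -!fE /adj /= /part_adj negbK => /eqP-> .
  by rewrite eq_sym.
have degx : k <= degree (val x).
  have -> : degree (val x) = degree (f (val x)).
    rewrite /degree -(card_imset _ (bij_inj bf)); apply: eq_card => z.
    case: bf => g gK fK; rewrite inE -[z]fK (mem_imset _ _ (can_inj gK)) inE fE.
    by [].
  have D := degree_multipartite (f (val x)); rewrite card_Kmulti_class in D.
  have A := ak (nth 0 a (tag (f (val x)))) (mem_nth 0 (ltn_ord _)).
  by rewrite -card_Kmulti -[#|Kmulti a|]D leq_add2r in A.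
case: (boolP (adj (val x) (val y))) => [xy|nxy]; first exact: connect1.
have : 0 < #|[set z | adj (val x) z] :\: S|.
  have := cardsID S [set z | adj (val x) z].
  have := subset_leq_card (subsetIr [set z | adj (val x) z] S).
  rewrite -/(degree (val x)); lia.
case/card_gt0P => z; rewrite !inE => /andP[zS xz].
apply: (@connect_trans _ _ (exist _ z zS : del S)); apply: connect1; first exact: xz.
exact: trans nxy xz.
Qed.

Lemma turan_number_sumn r n : turan_number r n = sumn [seq x - x %/ r | x <- iota 0 n].
Proof.
rewrite /turan_number -(big_mkord xpredT (fun x => x - x %/ r)) /index_iota subn0.
by rewrite sumnE big_map.
Qed.

Lemma Hhat_nedges n r m (l : int) (G : sgraph) : (l + 1)%R = m%:Z%R ->
  in_Hhat n r l G -> nedges G = turan_number r (n - 1) + m.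
Proof.
move=> lm [a ain /iso_nedges ->].
have : all (fun t : int * seq nat * nat * nat => let: (l, a, r, n) := t in
    (sumn a) ^ 2 == (sumn [seq x - x %/ r | x <- iota 0 (n - 1)] + `|(l + 1)%R|).*2 +
                    sumn [seq x ^ 2 | x <- a]) Hhat_table by vm_compute.
move=> /allP/(_ _ ain) /=; rewrite lm /= -turan_number_sumn.
by rewrite -nedges_Kmulti eqn_add2r => /eqP/double_inj.
Qed.

Lemma tight_table_Hhat m a r n (l : int) : (l + 1)%R = m%:Z%R ->
  (m, a, r, n) \in tight_table -> (l, a, r, n) \in Hhat_table.
Proof.
move=> lm ain; have -> : l = (m%:Z - 1)%R by rewrite -lm addrK.
have : all (fun t => let: (m, a, r, n) := t in
    ((m%:Z - 1)%R, a, r, n) \in Hhat_table) tight_table by vm_compute.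
by move=> /allP/(_ _ ain).
Qed.

(** For r >= m + 3 the Turán graph on m + 3 vertices is complete, and C(m + 4, 2) - 3 = C(m + 3, 2)
    + m. *)
Lemma star_like_nedges r m (G : sgraph) : 0 < r -> m.+3 <= r ->
  iso G (Kmulti (3 :: nseq m.+1 1)) -> nedges G = turan_number r (m + 3) + m.
Proof.
move=> r0 mr /iso_nedges ->; have := nedges_Kmulti (3 :: nseq m.+1 1).
have := turan_number_double (m + 3) r0.
have q : (m + 3) %/ r = (r == m + 3).
  by case: eqP => [->|ne]; rewrite ?divnn ?divn_small //; lia.
rewrite q /= map_nseq !sumn_nseq -!mulnn.
by case: eqP => [->|_] /=; lia.
Qed.

Lemma sporadic_nedges r m n (G : sgraph) : 0 < r ->
  sporadic r m n G -> nedges G = turan_number r (n - 1) + m.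
Proof.
move=> r0 [[_ mr -> isoG]|[a ain isoG]].
  by rewrite (star_like_nedges r0 mr isoG); congr (turan_number r _ + m); lia.
apply: (@Hhat_nedges n r m (m%:Z - 1)%R); first by rewrite subrK.
by exists a => //; apply: tight_table_Hhat ain; rewrite subrK.
Qed.

(** The deleted set may be smaller than allowed, giving some [m'] below [m]; the bound is then
    strict, so equality needs [m'] = [m]. *)
Lemma edge_bound (G : sgraph) r n m : 3 <= r -> admissible r m n ->
  #|G| = n -> clique_free r.+1 G -> (exists2 m', m' <= m & low m' G) ->
  nedges G <= nedges (turan r (n - 1)) + m /\
  (nedges G = nedges (turan r (n - 1)) + m ->
   (forall l : int, (l + 1)%R = m%:Z%R -> in_calG n r l G) \/ sporadic r m n G).
Proof.
move=> r3 adm nE cf [m' mm lowm']; rewrite nedges_turan; last by lia.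
rewrite -nE in adm *.
have [le eq] := low_edge_bound r3 cf (admissible_mono mm adm) lowm'.
split; first by lia.
have [<- //|mm' e] := eqVneq m' m; lia.
Qed.

Lemma not_k_hamiltonian_low (G : sgraph) k : k < #|G| -> ~ k_hamiltonian k G ->
  exists2 m', m' <= k.+1 & low m' G.
Proof.
move=> kG nH; have [S [Sk nHS]] : exists S : {set G}, #|S| <= k /\ ~ hamiltonian (del S).
  by apply: NNPP => H; apply: nH => S Sk; apply: NNPP => nHS; apply: H; exists S.
exists (1 + #|S|); first by lia.
by apply: low_del; apply: not_hamiltonian_low => //; rewrite card_del; lia.
Qed.

Lemma not_k_ham_connected_low (G : sgraph) k : k <= #|G| -> ~ k_ham_connected k G ->
  exists2 m', m' <= k.+1 & low m' G.
Proof.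
move=> kG nH; have [S [Sk nHS]] : exists S : {set G}, #|S| < k /\ ~ ham_connected (del S).
  by apply: NNPP => H; apply: nH => S Sk; apply: NNPP => nHS; apply: H; exists S.
exists (2 + #|S|); first by lia.
by apply: low_del; apply: not_ham_connected_low => //; rewrite card_del; lia.
Qed.

Lemma not_k_connected_low (G : sgraph) k : ~ k_connected k G ->
  exists2 m', m' <= k - 1 & low m' G.
Proof.
move=> nH; have [S [Sk nHS]] : exists S : {set G}, #|S| < k /\ ~ connected (del S).
  by apply: NNPP => H; apply: nH => S Sk; apply: NNPP => nHS; apply: H; exists S.
exists (0 + #|S|); first by lia.
by apply: low_del; apply: not_connected_low.
Qed.

(** One graph serves for nonemptiness and tightness: its vertex of degree [m] violates the
    property. *)
Lemma calG_extremal r n m (l : int) (P : sgraph -> Prop) : 3 <= r ->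
  admissible r m n -> m < n -> (l + 1)%R = m%:Z%R ->
  (forall (G : sgraph) (v : G), #|G| = n -> degree v = m -> ~ P G) ->
  (exists G, in_calG n r l G) /\
  exists G : sgraph, [/\ #|G| = n, clique_free r.+1 G, ~ P G
    & nedges G = nedges (turan r (n - 1)) + m].
Proof.
move=> r3 adm mn lm nP; have r0 : 0 < r by lia.
have n0 : 0 < n by lia.
have [G GG] := calG_exists r0 n0 (admissible_calG r3 adm mn) lm.
split; first by exists G.
exists G; rewrite nedges_turan //; have E := calG_nedges r0 lm GG.
case: GG => nE cf [v dv _]; split=> //; apply: (nP G v) => //.
by move: dv; rewrite lm => -[].
Qed.

(** Clears the denominator r - 4. The bound k + 5 <= n, due to 4(k + 4) >= 0, ensures that n - k - 5
    is not truncated. *)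
Lemma rat_threshold (r n k : nat) : 8 <= r ->
  (k%:R + 5 + 4 * (k%:R + 4) / (r%:R - 4) <= n%:R :> rat)%R ->
  4 * (k + 4) <= (r - 4) * (n - k - 5) /\ k + 5 <= n.
Proof.
move=> r8; have [s rs] : exists s, r = s + 4 by exists (r - 4); lia.
have s0 : (0 < s%:R :> rat)%R by rewrite ltr0n; lia.
have -> : (r%:R - 4 = s%:R :> rat)%R by rewrite rs natrD addrK.
rewrite -lerBrDl ler_pdivrMr // => h.
have kn : k + 5 <= n.
  have : (0 <= (n%:R - (k%:R + 5)) * s%:R :> rat)%R.
    by apply: le_trans h; rewrite mulr_ge0 // addr_ge0.
  by rewrite pmulr_lge0 // subr_ge0 -(natrD _ k 5) ler_nat.
split=> //; move: h; rewrite -(natrD _ k 5) -(natrB _ kn) -natrD -!natrM ler_nat rs addnK subnDA.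
by rewrite [s * _]mulnC.
Qed.

Theorem theorem4p3 (r n : nat) (hr : 3 <= r) :
  ((r = 3 -> 20 <= n) ->
   (4 <= r -> 1 <= n) ->
   [/\ forall G : sgraph, #|G| = n -> clique_free r.+1 G -> ~ traceable G ->
         nedges G <= nedges (turan r (n - 1)) /\
         (nedges G = nedges (turan r (n - 1)) <->
             in_calG n r (-1)%R G
          \/ [/\ 4 <= r, n = 4 & iso G (Kmulti [:: 3; 1])]
          \/ [/\ r = 4, n = 6 & iso G (Kmulti [:: 4; 1; 1])]
          \/ [/\ r = 4, n = 8 & iso G (Kmulti [:: 5; 1; 1; 1])]),
       exists G : sgraph, in_calG n r (-1)%R G
     & (1 < n -> exists G : sgraph,
         [/\ #|G| = n, clique_free r.+1 G, ~ traceable G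
           & nedges G = nedges (turan r (n - 1))])]) /\
  ((r = 3 -> 26 <= n) ->
   (r = 4 -> 11 <= n) ->
   (5 <= r -> 2 <= n) ->
   [/\ forall G : sgraph, #|G| = n -> clique_free r.+1 G -> ~ hamiltonian G ->
         nedges G <= nedges (turan r (n - 1)) + 1 /\
         (nedges G = nedges (turan r (n - 1)) + 1 <->
             in_calG n r 0%R G
          \/ [/\ 5 <= r, n = 5 & iso G (Kmulti [:: 3; 1; 1])]
          \/ [/\ r = 4, n = 11 & iso G (Kmulti [:: 6; 2; 2; 1])]
          \/ [/\ r = 5, n = 7 & iso G (Kmulti [:: 4; 1; 1; 1])]
          \/ [/\ r = 5, n = 9 & iso G (Kmulti [:: 5; 1; 1; 1; 1])]),
       exists G : sgraph, in_calG n r 0%R G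
     & exists G : sgraph,
         [/\ #|G| = n, clique_free r.+1 G, ~ hamiltonian G
           & nedges G = nedges (turan r (n - 1)) + 1]]) /\
  ((r = 3 -> 32 <= n) ->
   (r = 4 -> 16 <= n) ->
   (r = 5 -> 10 <= n) ->
   (6 <= r -> 4 <= n) ->
   [/\ forall G : sgraph, #|G| = n -> clique_free r.+1 G -> ~ ham_connected G ->
         nedges G <= nedges (turan r (n - 1)) + 2 /\
         (nedges G = nedges (turan r (n - 1)) + 2 <->
             in_calG n r 1%R G
          \/ [/\ 6 <= r, n = 6 & iso G (Kmulti [:: 3; 1; 1; 1])]
          \/ [/\ r = 6, n = 8 & iso G (Kmulti [:: 4; 1; 1; 1; 1])]
          \/ [/\ r = 5, n = 10 & iso G (Kmulti [:: 5; 2; 1; 1; 1])]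
          \/ [/\ r = 6, n = 10 & iso G (Kmulti [:: 5; 1; 1; 1; 1; 1])]),
       exists G : sgraph, in_calG n r 1%R G
     & exists G : sgraph,
         [/\ #|G| = n, clique_free r.+1 G, ~ ham_connected G
           & nedges G = nedges (turan r (n - 1)) + 2]]) /\
  (forall k : nat,
   (r = 3 -> 6 * k + 26 <= n) ->
   (4 <= r <= 7 -> 5 * k + 11 <= n) ->
   (8 <= r -> (k%:R + 5 + 4 * (k%:R + 4) / (r%:R - 4) <= n%:R :> rat)%R) ->
   [/\ forall G : sgraph, #|G| = n -> clique_free r.+1 G -> ~ k_hamiltonian k G ->
         nedges G <= nedges (turan r (n - 1)) + (k + 1) /\
         (nedges G = nedges (turan r (n - 1)) + (k + 1) <->
             in_calG n r (k%:Z)%R G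
          \/ in_Hhat n r (k%:Z)%R G),
       exists G : sgraph, in_calG n r (k%:Z)%R G
     & exists G : sgraph,
         [/\ #|G| = n, clique_free r.+1 G, ~ k_hamiltonian k G
           & nedges G = nedges (turan r (n - 1)) + (k + 1)]]) /\
  (forall k : nat, 1 <= k ->
   (r = 3 -> 6 * k + 26 <= n) ->
   (r = 4 -> 5 * k + 11 <= n) ->
   (5 <= r <= 7 -> 3 * k + 7 <= n) ->
   (8 <= r -> (k%:R + 5 + 4 * (k%:R + 4) / (r%:R - 4) <= n%:R :> rat)%R) ->
   [/\ forall G : sgraph, #|G| = n -> clique_free r.+1 G -> ~ k_ham_connected k G ->
         nedges G <= nedges (turan r (n - 1)) + (k + 1) /\
         (nedges G = nedges (turan r (n - 1)) + (k + 1) <->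
             in_calG n r (k%:Z)%R G
          \/ in_Hhat n r (k%:Z)%R G),
       exists G : sgraph, in_calG n r (k%:Z)%R G
     & exists G : sgraph,
         [/\ #|G| = n, clique_free r.+1 G, ~ k_ham_connected k G
           & nedges G = nedges (turan r (n - 1)) + (k + 1)]]) /\
  (forall k : nat, 1 <= k ->
   (r = 3 -> 6 * k + 14 <= n) ->
   (4 <= r <= 7 -> 5 * k + 1 <= n) ->
   (8 <= r -> 2 * k + 5 <= n) ->
   [/\ forall G : sgraph, #|G| = n -> clique_free r.+1 G -> ~ k_connected k G ->
         nedges G <= nedges (turan r (n - 1)) + (k - 1) /\
         (nedges G = nedges (turan r (n - 1)) + (k - 1) <->
             in_calG n r (k%:Z - 2)%R G),
       exists G : sgraph, in_calG n r (k%:Z - 2)%R G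
     & exists G : sgraph,
         [/\ #|G| = n, clique_free r.+1 G, ~ k_connected k G
           & nedges G = nedges (turan r (n - 1)) + (k - 1)]]).
Proof.
have r0 : 0 < r by lia.
have tableP (m : nat) (a : seq nat) : (m, a, r, n) \in tight_table ->
    [\/ [\/ (m, a, r, n) = (0, [:: 4; 1; 1], 4, 6) | (m, a, r, n) = (0, [:: 5; 1; 1; 1], 4, 8)],
        [\/ (m, a, r, n) = (1, [:: 6; 2; 2; 1], 4, 11),
            (m, a, r, n) = (1, [:: 4; 1; 1; 1], 5, 7)
          | (m, a, r, n) = (1, [:: 5; 1; 1; 1; 1], 5, 9)],
        [\/ (m, a, r, n) = (2, [:: 4; 1; 1; 1; 1], 6, 8),
            (m, a, r, n) = (2, [:: 5; 2; 1; 1; 1], 5, 10)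
          | (m, a, r, n) = (2, [:: 5; 1; 1; 1; 1; 1], 6, 10)]
      | (m, a, r, n) = (3, [:: 6; 2; 2; 2; 1], 5, 13)].
  rewrite !inE => /orP[/eqP ?|/orP[/eqP ?|/orP[/eqP ?|/orP[/eqP ?|/orP[/eqP ?|
     /orP[/eqP ?|/orP[/eqP ?|/orP[/eqP ?|/eqP ?]]]]]]]].
  - by apply: Or41; left.
  - by apply: Or41; right.
  - by apply: Or42; apply: Or31.
  - by apply: Or42; apply: Or32.
  - by apply: Or42; apply: Or33.
  - by apply: Or43; apply: Or31.
  - by apply: Or43; apply: Or32.
  - by apply: Or43; apply: Or33.
  - exact: Or44.
split.

  (* Traceability, [m] = 0 *)
  move=> h3 h4; have n0 : 0 < n by case: (eqVneq r 3) => [/h3|]; lia.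
  have adm : admissible r 0 n.
    by split=> hr'; [have := h3 hr'; lia|left|apply: Or31|left].
  have l0 : (-1 + 1)%R = 0%:Z%R by [].
  (* Nonemptiness is proved apart from tightness, because for n = 1 the graph in calG is a single
     vertex, which is traceable. *)
  have GE := calG_exists r0 n0 (admissible_calG hr adm n0) l0.
  split=> // [G nE cf nP|n1].
    have lowG : exists2 m', m' <= 0 & low m' G.
      by exists 0 => //; apply: not_traceable_low nP; rewrite nE.
    have := edge_bound hr adm nE cf lowG; rewrite addn0 => -[le eq].
    split=> //; split.
      move=> /eq[/(_ _ l0)|[[_ r3 n4 isoG]|[a /tableP ain isoG]]]; first by left.
        right; left; split=> //; case: (eqVneq r 3) => [/h3|]; lia.
      right; right; case: ain => [[|]|[||]|[||]|] // [Ea Er En]; rewrite Ea in isoG.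
        by left.
      by right.
    rewrite nedges_turan // -[turan_number _ _]addn0.
    case=> [/(calG_nedges r0 l0)//|[[r4 n4 isoG]|[[r4 n6 isoG]|[r4 n8 isoG]]]];
      apply: sporadic_nedges => //.
    - by left.
    - by right; exists [:: 4; 1; 1]; rewrite ?r4 ?n6.
    - by right; exists [:: 5; 1; 1; 1]; rewrite ?r4 ?n8.
  have [G v nE dv|_ [G HG]] := calG_extremal (P := traceable) hr adm n0 l0.
    by move=> /traceable_connected; apply: isolated_not_connected dv _; rewrite nE.
  by rewrite addn0 in HG; exists G.
split.

  (* Hamiltonicity, [m] = 1 *)
  move=> h3 h4 h5; have n1 : 1 < n.
    by case: (eqVneq r 3) => [/h3|]; case: (eqVneq r 4) => [/h4|]; lia.
  have adm : admissible r 1 n.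
    by split=> hr'; [have := h3 hr'; lia|right; have := h4 hr'; lia|apply: Or31|left].
  have l0 : (0 + 1)%R = 1%:Z%R by [].
  have [G v nE dv|GE HG] := calG_extremal (P := hamiltonian) hr adm n1 l0.
    by move=> /(hamiltonian_degree v); rewrite dv.
  split=> // G nE cf nP.
  have lowG : exists2 m', m' <= 1 & low m' G.
    by exists 1 => //; apply: not_hamiltonian_low nP; rewrite nE; lia.
  have [le eq] := edge_bound hr adm nE cf lowG.
  split=> //; split.
    move=> /eq[/(_ _ l0)|[[_ r3 n4 isoG]|[a /tableP ain isoG]]]; first by left.
      by right; left; split=> //; case: (eqVneq r 4) => [/h4|]; lia.
    right; right; case: ain => [[|]|[||]|[||]|] // [Ea Er En]; rewrite Ea in isoG.
    - by left.
    - by right; left.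
    - by right; right.
  rewrite nedges_turan //.
  case=> [/(calG_nedges r0 l0)//|[[r5 n5 isoG]|[[r4 n6 isoG]|[[r4 n8 isoG]|[r4 n8 isoG]]]]];
    apply: sporadic_nedges => //.
  - by left; split=> //; lia.
  - by right; exists [:: 6; 2; 2; 1]; rewrite ?r4 ?n6.
  - by right; exists [:: 4; 1; 1; 1]; rewrite ?r4 ?n8.
  - by right; exists [:: 5; 1; 1; 1; 1]; rewrite ?r4 ?n8.
split.

  (* Hamiltonian-connectedness, [m] = 2 *)
  move=> h3 h4 h5 h6; have n4 : 3 < n.
    by case: (eqVneq r 3) => [/h3|]; case: (eqVneq r 4) => [/h4|]; case: (eqVneq r 5) => [/h5|];
      lia.
  have n2 : 2 < n by lia.
  have adm : admissible r 2 n.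
    split=> hr'; [have := h3 hr'; lia|right; have := h4 hr'; lia| |by left].
    by case: (eqVneq r 5) => [/h5 ?|?]; [apply: Or33|apply: Or32]; lia.
  have l0 : (1 + 1)%R = 2%:Z%R by [].
  have [G v nE dv|GE HG] := calG_extremal (P := ham_connected) hr adm n2 l0.
    by rewrite -nE in n4; move=> /(ham_connected_degree v n4); rewrite dv.
  split=> // G nE cf nP.
  have lowG : exists2 m', m' <= 2 & low m' G.
    by exists 2 => //; apply: not_ham_connected_low nP; rewrite nE; lia.
  have [le eq] := edge_bound hr adm nE cf lowG.
  split=> //; split.
    move=> /eq[/(_ _ l0)|[[_ r5 n6 isoG]|[a /tableP ain isoG]]]; first by left.
      by right; left; split=> //; case: (eqVneq r 5) => [/h5|]; lia.
    right; right; case: ain => [[|]|[||]|[||]|] // [Ea Er En]; rewrite Ea in isoG.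
    - by left.
    - by right; left.
    - by right; right.
  rewrite nedges_turan //.
  case=> [/(calG_nedges r0 l0)//|[[r5 n5 isoG]|[[r4 n6 isoG]|[[r4 n8 isoG]|[r4 n8 isoG]]]]];
    apply: sporadic_nedges => //.
  - by left; split=> //; lia.
  - by right; exists [:: 4; 1; 1; 1; 1]; rewrite ?r4 ?n6.
  - by right; exists [:: 5; 2; 1; 1; 1]; rewrite ?r4 ?n8.
  - by right; exists [:: 5; 1; 1; 1; 1; 1]; rewrite ?r4 ?n8.
have lk (k : nat) : (k%:Z + 1)%R = (k + 1)%:Z%R by [].
(* K_{3,1,...,1} has m + 4 = k + 5 vertices, and the thresholds of the next two parts force n > k +
   5; only table entries remain. *)
have sporHhat (k : nat) (G : sgraph) : n != k + 5 -> sporadic r (k + 1) n G -> in_Hhat n r k%:Z%R G.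
  move=> nk [[_ _ n5 _]|[a ain isoG]]; first by lia.
  by exists a => //; apply: tight_table_Hhat ain.
split.

  (* k-Hamiltonicity, [m] = k + 1 *)
  move=> k h3 h4 h8.
  have [adm nk] : admissible r (k + 1) n /\ k + 5 < n.
    have R8 : 8 <= r -> 4 * (k + 4) <= (r - 4) * (n - k - 5) /\ k + 5 <= n.
      by move=> r8; apply: rat_threshold (h8 r8).
    split.
      split=> hr'; [by have := h3 hr'; lia|by right; have := h4; rewrite hr' => /(_ isT); lia| |].
        by apply: Or33; have := h4; lia.
      right; have [] := R8 hr'; have -> : n - (k + 1) - 4 = n - k - 5 by lia.
      by rewrite -addnA.
    case: (eqVneq r 3) => [/h3|?]; first lia.
    case: (ltnP r 8) => [?|r8]; first by have := h4; lia.
    (* At n = k + 5 the right side of [R] is 0 while its left side is positive. *)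
    have [R kn] := R8 r8; rewrite ltn_neqAle kn andbT; apply: contraTneq R => <-.
    by rewrite -subnDA subnn muln0 -ltnNge; lia.
  have kn : k + 1 < n by lia.
  have [G v nE dv|GE HG] := calG_extremal (P := k_hamiltonian k) hr adm kn (lk k).
    by apply: (low_degree_not_k_hamiltonian (v := v)); rewrite dv addn1.
  split=> // G nE cf nP.
  have lowG : exists2 m', m' <= k + 1 & low m' G.
    by rewrite addn1; apply: not_k_hamiltonian_low nP; rewrite nE; lia.
  have [le eq] := edge_bound hr adm nE cf lowG.
  split=> //; split.
    by move=> /eq[/(_ _ (lk k))|sp]; [left|right; apply: sporHhat sp; lia].
  by rewrite nedges_turan // => -[/(calG_nedges r0 (lk k))|/(Hhat_nedges (lk k))].
split.

  (* k-Hamiltonian-connectedness, [m] = k + 1 *)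
  move=> k k1 h3 h4 h5 h8.
  have [adm nk] : admissible r (k + 1) n /\ k + 5 < n.
    have R8 : 8 <= r -> 4 * (k + 4) <= (r - 4) * (n - k - 5) /\ k + 5 <= n.
      by move=> r8; apply: rat_threshold (h8 r8).
    split.
      split=> hr'; [by have := h3 hr'; lia|by right; have := h4 hr'; lia| |].
        by apply: Or33; have := h5; lia.
      right; have [] := R8 hr'; have -> : n - (k + 1) - 4 = n - k - 5 by lia.
      by rewrite -addnA.
    case: (eqVneq r 3) => [/h3|?]; first lia.
    case: (eqVneq r 4) => [/h4|?]; first lia.
    case: (ltnP r 8) => [?|r8]; first by have := h5; lia.
    have [R kn] := R8 r8; rewrite ltn_neqAle kn andbT; apply: contraTneq R => <-.
    by rewrite -subnDA subnn muln0 -ltnNge; lia.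
  have kn : k + 1 < n by lia.
  have [G v nE dv|GE HG] := calG_extremal (P := k_ham_connected k) hr adm kn (lk k).
    by apply: (low_degree_not_k_ham_connected (v := v)); rewrite ?dv ?nE; lia.
  split=> // G nE cf nP.
  have lowG : exists2 m', m' <= k + 1 & low m' G.
    by rewrite addn1; apply: not_k_ham_connected_low nP; rewrite nE; lia.
  have [le eq] := edge_bound hr adm nE cf lowG.
  split=> //; split.
    by move=> /eq[/(_ _ (lk k))|sp]; [left|right; apply: sporHhat sp; lia].
  by rewrite nedges_turan // => -[/(calG_nedges r0 (lk k))|/(Hhat_nedges (lk k))].

(* k-connectedness, [m] = k - 1 *)
move=> k k1 h3 h4 h8.
have [adm nk] : admissible r (k - 1) n /\ k + 5 <= n.
  split; last first.
    by case: (eqVneq r 3) => [/h3|?]; [lia|case: (ltnP r 8) => ?; have := h4; have := h8; lia].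
  split=> hr'; [by have := h3 hr'; lia|by right; have := h4; rewrite hr' => /(_ isT); lia| |].
    by apply: Or33; have := h4; lia.
  right; apply: (@leq_trans (4 * (n - (k - 1) - 4))); first by have := h8 hr'; lia.
  by rewrite leq_mul2r; apply/orP; right; lia.
have kn : k - 1 < n by lia.
have lk2 : (k%:Z - 2 + 1)%R = (k - 1)%:Z%R by lia.
have [G v nE dv|GE HG] := calG_extremal (P := k_connected k) hr adm kn lk2.
  by apply: (low_degree_not_k_connected (v := v)); rewrite ?dv ?nE; lia.
split=> // G nE cf nP.
have [le eq] := edge_bound hr adm nE cf (not_k_connected_low nP).
split=> //; split; last by rewrite nedges_turan // => /(calG_nedges r0 lk2).
(* K_{3,1,...,1} would have k + 3 vertices, too few. In the table, 5k + 1 <= n leaves K_{4,1,1} and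
   K_{5,1,1,1} with k = 1 and K_{6,2,2,1} with k = 2, and these are k-connected. *)
move=> /eq[/(_ _ lk2)//|[[_ mr nm _]|[a /tableP ain isoG]]].
  by case: (eqVneq r 3) => [/h3|?]; [lia|case: (ltnP r 8) => ?; have := h4; have := h8; lia].
case: ain => [[|]|[||]|[||]|] [Em Ea Er En]; have := h4; rewrite Er En => /(_ isT) kle;
  try lia; case: nP; rewrite Ea in isoG; apply: (Kmulti_k_connected isoG);
  by (have -> : k = (k - 1).+1 by lia); rewrite Em.
Qed.
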